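(* Let $\alpha>0$. Suppose there exist a continuously differentiable function $Q:[t_0,t_f]\to\mathbb{S}^{n_x}_{++}$, piecewise continuous functions $Y:[t_0,t_f]\to\mathbb{R}^{n_u\times n_x}$ and $\lambda_w:[t_0,t_f]\to\mathbb{R}_+$, and functions $N_1:[t_0,t_f]\to\mathbb{S}^{n_q}$ and $N_2:[t_0,t_f]\to\mathbb{S}^{n_p}$ such that $(N_1(t),N_2(t))\in\mathcal{N}(t)$, $0\le\lambda_w(t)\le\alpha$, and the following differential linear matrix inequality holds for almost all $t\in[t_0,t_f]$: $$\begin{bmatrix} H_{11}(t)+H_{11}(t)^\top-\dot Q(t) & H_{12}(t)^\top\\ H_{12}(t) & H_{22}(t)\end{bmatrix}\preceq 0,$$ where (omitting the argument $t$) $$H_{11}=AQ+BY-ET_{22}^{-1}T_{21}(CQ+DY)+\tfrac{\alpha}{2}Q,$$ $$H_{12}=\begin{bmatrix} N_2T_{22}^{-\top}E^\top\\ F^\top-G^\top T_{21}^\top T_{22}^{-\top}E^\top\\ \Sigma(CQ+DY)\end{bmatrix},\qquad H_{22}=\begin{bmatrix} -N_2 & 0 & N_2\Lambda^\top\\ 0 & -\lambda_w I & G^\top\Sigma^\top\\ \Lambda N_2 & \Sigma G & -N_1\end{bmatrix},$$ $$\Lambda=T_{12}T_{22}^{-1},\qquad \Sigma=T_{11}-T_{12}T_{22}^{-1}T_{21}.$$ Define the feedback gain $K(t)=Y(t)Q(t)^{-1}$ and $V(t,\eta)=\eta^\top Q(t)^{-1}\eta$. Then, along every trajectory $\eta(\cdot)$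 of the incremental system with $\xi(t)=K(t)\eta(t)$ and any admissible disturbance $w$, the inequality $$\dot V(t,\eta(t))+\alpha V(t,\eta(t))-\lambda_w(t)w(t)^\top w(t)\le 0,\qquad 0\le\lambda_w(t)\le\alpha,$$ holds for almost all $t\in[t_0,t_f]$, and the funnel $\mathcal{F}(t)$ with level constant $c_Q=w_{max}^2$ is invariant for the nonlinear system.
   Context: Notation: $\mathbb{S}^n$, $\mathbb{S}^n_{++}$ are the real symmetric and the symmetric positive definite $n\times n$ matrices; $\mathbb{R}_+=[0,\infty)$; $\oplus$ is the Minkowski sum. Fix $t_0\le t_f<\infty$. Nonlinear system: $\dot x(t)=f(t,x(t),u(t),w(t))$, $t\in[t_0,t_f]$, with $x\in\mathbb{R}^{n_x}$, $u\in\mathbb{R}^{n_u}$, $w\in\mathbb{R}^{n_w}$, $f$ continuous in $t$ and continuously differentiable in the other arguments. Inputs $u$ are piecewise continuous and in $L_2$. A disturbance $w(\cdot)$ is admissible if it is in $L_2$, continuous almost everywhere, and $\operatorname{ess\,sup}_{t\in[t_0,t_f]}\|w(t)\|_2\le w_{max}$, where $w_{max}\ge0$ is given. Solutions are absolutely continuous and satisfy the equation for almost all $t$. Linear fractional form: $f(t,x,u,w)=A_o(t)x+B_o(t)u+F_o(t)w+E\phi(t,q_o)$, $q_o=C_ox+D_ou+G_ow$, with $A_o,B_o,F_o$ continuous and bounded on $[t_0,t_f]$, constant matrices $E,C_o,D_o,G_o$, and $\phi:[t_0,t_f]\times\mathbb{R}^{n_{q_o}}\to\mathbb{R}^{n_\phi}$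 a known function, differentiable in its second argument. The nominal trajectory $(\bar x,\bar u)$ satisfies $\dot{\bar x}(t)=f(t,\bar x(t),\bar u(t),0)$; set $\bar q_o=C_o\bar x+D_o\bar u$. Channels: the components of $\phi$ are grouped, in order, into $n_c$ channels $\phi_{[i]}(t,q_{[i]})\in\mathbb{R}^{n_{p_{[i]}}}$, $i=1,\dots,n_c$, where $q_{[i]}\in\mathbb{R}^{n_{q_{[i]}}}$ consists of those entries of $q_o$ on which $\phi_{[i]}$ depends, $q_{[i]}=C_ix+D_iu+G_iw$. Put $\bar q_{[i]}=C_i\bar x+D_i\bar u$, and with $\phi_{[i]}'$ the Jacobian in the second argument, $$\delta p_{[i]}(t,\delta q_{[i]})=\phi_{[i]}(t,\bar q_{[i]}(t)+\delta q_{[i]})-\phi_{[i]}(t,\bar q_{[i]}(t))-\phi_{[i]}'(t,\bar q_{[i]}(t))\,\delta q_{[i]}.$$ Let $\delta q\in\mathbb{R}^{n_q}$, $\delta p\in\mathbb{R}^{n_p}$ be the stacks of the $\delta q_{[i]}$, $\delta p_{[i]}$ ($n_q=\sum_i n_{q_{[i]}}$, $n_p=\sum_i n_{p_{[i]}}=n_\phi$), and let $C,D,G$ be the vertical stacks of the $C_i,D_i,G_i$. Incremental system: for $\eta=x-\bar x$, $\xi=u-\bar u$, $$\dot\eta=A(t)\eta+B(t)\xi+F(t)w+E\,\delta p(t,\delta q),\qquad \delta q=C\eta+D\xi+Gw,$$ where $A=A_o+E\Phi C_o$, $B=B_o+E\Phi D_o$, $F=F_o+E\Phi G_o$ and $\Phi(t)$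 is the Jacobian of $\phi(t,\cdot)$ at $\bar q_o(t)$. Incremental quadratic constraint: $\mathcal{M}(t)$ is the set of all $M\in\mathbb{S}^{n_q+n_p}$ with $\begin{bmatrix}\delta q\\ \delta p(t,\delta q)\end{bmatrix}^\top M\begin{bmatrix}\delta q\\ \delta p(t,\delta q)\end{bmatrix}\ge0$ for all $\delta q\in\mathbb{R}^{n_q}$. For each $t$ a nonsingular matrix $T(t)=\begin{bmatrix} T_{11}(t) & T_{12}(t)\\ T_{21}(t) & T_{22}(t)\end{bmatrix}\in\mathbb{R}^{(n_q+n_p)\times(n_q+n_p)}$, with $T_{11}(t)$ of size $n_q\times n_q$ and $T_{22}(t)$ of size $n_p\times n_p$ nonsingular, is given. $\mathcal{N}(t)$ is the set of pairs $(N_1,N_2)\in\mathbb{S}^{n_q}\times\mathbb{S}^{n_p}$ of invertible matrices such that $T(t)^\top\begin{bmatrix}N_1^{-1}&0\\ 0&-N_2^{-1}\end{bmatrix}T(t)\in\mathcal{M}(t)$. Funnel: given $Q$, $K$ and a level constant $c_Q\ge0$, put $\mathcal{E}_\eta(t)=\{\eta\in\mathbb{R}^{n_x}:\eta^\top Q(t)^{-1}\eta\le c_Q\}$, $\mathcal{E}_\xi(t)=\{(c_QK(t)Q(t)K(t)^\top)^{1/2}y: y\in\mathbb{R}^{n_u},\ \|y\|_2\le1\}$, and $\mathcal{F}(t)=(\{\bar x(t)\}\oplus\mathcal{E}_\eta(t))\times(\{\bar u(t)\}\oplus\mathcal{E}_\xi(t))$. The funnel is invariant for the nonlinear system if, whenever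 $x(\cdot)$ is a solution with $x(t_0)\in\{\bar x(t_0)\}\oplus\mathcal{E}_\eta(t_0)$, control $u(t)=\bar u(t)+K(t)(x(t)-\bar x(t))$, and an admissible disturbance $w$, one has $(x(t),u(t))\in\mathcal{F}(t)$ for all $t\in[t_0,t_f]$. *)

(* Defs.v *)
From HB Require Import structures.
From mathcomp Require Import all_boot all_order all_algebra.
From mathcomp Require Import all_classical all_reals all_analysis ess_sup_inf.

Set Implicit Arguments.
Unset Strict Implicit.
Unset Printing Implicit Defensive.

Import Order.TTheory GRing.Theory Num.Theory.
Import numFieldNormedType.Exports.

Local Open Scope classical_set_scope.
Local Open Scope ring_scope.

(* A function on [a, b] is a total function
   on R about which only the values on `[a, b] are ever constrained or used. *)

Definition sqnorm2 (R : realType) (n : nat) (v : 'cV[R]_n) : R :=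
  (v^T *m v) 0 0.

(* The library norm of a matrix is the max norm; this is the Euclidean one. *)
Definition norm2 (R : realType) (n : nat) (v : 'cV[R]_n) : R :=
  Num.sqrt (sqnorm2 v).

Definition qform (R : realType) (n : nat) (M : 'M[R]_n) (v : 'cV[R]_n) : R :=
  (v^T *m M *m v) 0 0.

Definition posdef (R : realType) (n : nat) (M : 'M[R]_n) : Prop :=
  M \is symmetricmx /\ (forall v, v != 0 -> 0 < qform M v).

Definition possemidef (R : realType) (n : nat) (M : 'M[R]_n) : Prop :=
  M \is symmetricmx /\ (forall v, 0 <= qform M v).

Definition negsemidef (R : realType) (n : nat) (M : 'M[R]_n) : Prop :=
  M \is symmetricmx /\ (forall v, qform M v <= 0).

(* The unique positive semidefinite square root of a positive semidefinite
   matrix M (0 if M has no such root). *)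
Definition sqrtmx (R : realType) (n : nat) (M : 'M[R]_n) : 'M[R]_n :=
  xget 0 [set S : 'M[R]_n | possemidef S /\ S *m S = M].

(* 'J of the library acts on row vectors from the right; this is the usual
   matrix of partial derivatives, acting on column vectors from the left. *)
Definition jacobian_col (R : realType) (m n : nat)
    (g : 'cV[R]_n -> 'cV[R]_m) (q : 'cV[R]_n) : 'M[R]_(m, n) :=
  \matrix_(i, j) ('D_(delta_mx j 0) g q) i 0.

Definition ae_on (R : realType) (a b : R) (P : R -> Prop) : Prop :=
  {ae (@lebesgue_measure R), forall t, t \in `[a, b] -> P t}.

(* One-sided limits are finite and exist at every point; the value at each of
   the finitely many points of s (and at a, b) is arbitrary. *)
Definition piecewise_continuous (R : realType) (V : normedModType R) (a b : R)
    (g : R -> V) : Prop :=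
  [/\ exists s : seq R, forall t, t \in `]a, b[ -> t \notin s ->
        {for t, continuous g},
      forall t, t \in `[a, b[ -> cvg (g @ t^'+) &
      forall t, t \in `]a, b] -> cvg (g @ t^'-)].

(* Derivatives at the two end points are one-sided. *)
Definition continuously_differentiable_on (R : realType) (V : normedModType R)
    (a b : R) (g : R -> V) : Prop :=
  exists2 dg : R -> V, {within `[a, b], continuous dg} &
    forall t, t \in `[a, b] ->
      (fun s : R => (s - t)^-1 *: (g s - g t)) @ within `[a, b] t^' --> dg t.

Definition absolutely_continuous_on (R : realType) (V : normedModType R)
    (a b : R) (g : R -> V) : Prop :=
  forall e : R, 0 < e -> exists2 d : R, 0 < d &
    forall (m : nat) (l r : 'I_m -> R),
      (forall k, a <= l k /\ l k <= r k /\ r k <= b) ->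
      (forall j k, j != k -> r j <= l k \/ r k <= l j) ->
      \sum_k (r k - l k) < d ->
      \sum_k `|g (r k) - g (l k)| < e.

(* Square integrability with respect to the Lebesgue sigma-algebra: lebesgue_measure
   lives on the Borel sets, and every Lebesgue measurable function agrees almost
   everywhere with a Borel one. *)
Definition L2_on (R : realType) (n : nat) (a b : R) (g : R -> 'cV[R]_n) : Prop :=
  forall i, exists2 h : R -> R, h \in Lfun (@lebesgue_measure R) 2%:E &
    ae_on a b (fun t => g t i 0 = h t).

Definition ess_sup_on (R : realType) (a b : R) (g : R -> R) : \bar R :=
  ess_sup (mrestr (@lebesgue_measure R) (measurable_itv `[a, b])) (EFin \o g).

Definition admissible_disturbance (R : realType) (nw : nat) (t0 tf wmax : R)
    (w : R -> 'cV[R]_nw) : Prop :=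
  [/\ L2_on t0 tf w,
      ae_on t0 tf (fun t => {for t, continuous w}) &
      (ess_sup_on t0 tf (fun t => norm2 (w t)) <= wmax%:E)%E].

Definition is_solution (R : realType) (nx nu nw : nat) (t0 tf : R)
    (f : R -> 'cV[R]_nx -> 'cV[R]_nu -> 'cV[R]_nw -> 'cV[R]_nx)
    (x : R -> 'cV[R]_nx) (u : R -> 'cV[R]_nu) (w : R -> 'cV[R]_nw) : Prop :=
  absolutely_continuous_on t0 tf x /\
  ae_on t0 tf (fun t => is_derive t 1 x (f t (x t) (u t) (w t))).

Definition continuously_differentiable (R : realType) (V W : normedModType R)
    (g : V -> W) : Prop :=
  (forall z, differentiable g z) /\ (forall v, continuous (fun z => 'D_v g z)).

(* The stack of the channelwise linearization errors; phi_ i t is the i-th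
   channel and qbar i t its nominal argument. *)
Definition delta_p (R : realType) (nc : nat) (nq np : 'I_nc -> nat)
    (phi_ : forall i : 'I_nc, R -> 'cV[R]_(nq i) -> 'cV[R]_(np i))
    (qbar : forall i : 'I_nc, R -> 'cV[R]_(nq i))
    (t : R) (dq : 'cV[R]_(\sum_i nq i)%N) : 'cV[R]_(\sum_i np i)%N :=
  \mxcol_i (phi_ i t (qbar i t + submxcol dq i) - phi_ i t (qbar i t)
            - jacobian_col (phi_ i t) (qbar i t) *m submxcol dq i).

Definition iqc_multipliers (R : realType) (nq np : nat)
    (dp : 'cV[R]_nq -> 'cV[R]_np) : set 'M[R]_(nq + np) :=
  [set M | M \is symmetricmx /\
           forall dq : 'cV[R]_nq, 0 <= qform M (col_mx dq (dp dq))].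

Definition iqc_pairs (R : realType) (nq np : nat) (T : 'M[R]_(nq + np))
    (dp : 'cV[R]_nq -> 'cV[R]_np) : set ('M[R]_nq * 'M[R]_np) :=
  [set N | [/\ N.1 \is symmetricmx, N.2 \is symmetricmx,
               N.1 \in unitmx, N.2 \in unitmx &
               iqc_multipliers dp
                 (T^T *m block_mx (invmx N.1) 0 0 (- invmx N.2) *m T)]].

Definition dlmi_matrix (R : realType) (nx nu nw nq np : nat) (alpha : R)
    (A : 'M[R]_nx) (B : 'M[R]_(nx, nu)) (F : 'M[R]_(nx, nw))
    (E : 'M[R]_(nx, np))
    (C : 'M[R]_(nq, nx)) (D : 'M[R]_(nq, nu)) (G : 'M[R]_(nq, nw))
    (T : 'M[R]_(nq + np))
    (Q dQ : 'M[R]_nx) (Y : 'M[R]_(nu, nx)) (lambda : R)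
    (N1 : 'M[R]_nq) (N2 : 'M[R]_np) : 'M[R]_(nx + (np + nw + nq)) :=
  let T11 := ulsubmx T in let T12 := ursubmx T in
  let T21 := dlsubmx T in let T22 := drsubmx T in
  let Lambda := T12 *m invmx T22 in
  let Sigma := T11 - T12 *m invmx T22 *m T21 in
  let H11 := A *m Q + B *m Y
             - E *m invmx T22 *m T21 *m (C *m Q + D *m Y)
             + (alpha / 2) *: Q in
  let H12 := col_mx
    (col_mx (N2 *m (invmx T22)^T *m E^T)
            (F^T - G^T *m T21^T *m (invmx T22)^T *m E^T))
    (Sigma *m (C *m Q + D *m Y)) in
  let H22 := block_mx
    (block_mx (- N2) 0
              0      (- lambda%:M))     (col_mx (N2 *m Lambda^T)
                                                (G^T *m Sigma^T))
    (row_mx (Lambda *m N2) (Sigma *m G)) (- N1) in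
  block_mx (H11 + H11^T - dQ) H12^T
           H12                H22.

Definition minkowski_sum (V : zmodType) (X Y : set V) : set V :=
  [set x + y | x in X & y in Y].

Definition state_ellipsoid (R : realType) (nx : nat) (cQ : R) (Q : 'M[R]_nx) :
    set 'cV[R]_nx :=
  [set eta | qform (invmx Q) eta <= cQ].

Definition input_ellipsoid (R : realType) (nx nu : nat) (cQ : R)
    (Q : 'M[R]_nx) (K : 'M[R]_(nu, nx)) : set 'cV[R]_nu :=
  [set sqrtmx (cQ *: (K *m Q *m K^T)) *m y | y in [set y | norm2 y <= 1]].

Definition funnel (R : realType) (nx nu : nat) (cQ : R)
    (xbar : R -> 'cV[R]_nx) (ubar : R -> 'cV[R]_nu)
    (Q : R -> 'M[R]_nx) (K : R -> 'M[R]_(nu, nx)) (t : R) :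
    set ('cV[R]_nx * 'cV[R]_nu) :=
  minkowski_sum [set xbar t] (state_ellipsoid cQ (Q t)) `*`
  minkowski_sum [set ubar t] (input_ellipsoid cQ (Q t) (K t)).

Definition funnel_invariant (R : realType) (nx nu nw : nat) (t0 tf wmax : R)
    (f : R -> 'cV[R]_nx -> 'cV[R]_nu -> 'cV[R]_nw -> 'cV[R]_nx) (cQ : R)
    (xbar : R -> 'cV[R]_nx) (ubar : R -> 'cV[R]_nu)
    (Q : R -> 'M[R]_nx) (K : R -> 'M[R]_(nu, nx)) : Prop :=
  forall (x : R -> 'cV[R]_nx) (w : R -> 'cV[R]_nw),
    let u := fun t => ubar t + K t *m (x t - xbar t) in
    admissible_disturbance t0 tf wmax w ->
    is_solution t0 tf f x u w ->
    minkowski_sum [set xbar t0] (state_ellipsoid cQ (Q t0)) (x t0) ->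
    forall t, t \in `[t0, tf] -> funnel cQ xbar ubar Q K t (x t, u t).

(* Main.v *)
Require Import Defs.
From HB Require Import structures.
From mathcomp Require Import all_boot all_order all_algebra.
From mathcomp Require Import all_classical all_reals all_analysis ess_sup_inf.
From mathcomp Require Import ring lra complex.

Set Implicit Arguments.
Unset Strict Implicit.
Unset Printing Implicit Defensive.

Import Order.TTheory GRing.Theory Num.Theory.
Import numFieldNormedType.Exports.

Local Open Scope classical_set_scope.
Local Open Scope ring_scope.

(** The argument is the classical one for ellipsoidal invariant sets, with
    [V t eta = eta^T Q(t)^-1 eta] as a Lyapunov function.

    Pointwise in time everything is linear algebra.  Put [zeta = Q^-1 eta], so
    that [eta = Q zeta] and [xi = K eta = Y zeta], and let
    [(a, b) = T (dq, dp)].  The multiplier condition then says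
    [b^T N2^-1 b <= a^T N1^-1 a].  Evaluating the quadratic form of the matrix
    inequality at [(zeta, N2^-1 b, w, N1^-1 a)] makes all the blocks recombine
    into [V' + alpha V - lambda |w|^2] plus the nonnegative number
    [a^T N1^-1 a - b^T N2^-1 b]; this is [dlmi_dissipation].  At an interior
    time where [eta] is differentiable, the chain rule and
    [(Q^-1)' = - Q^-1 Q' Q^-1] identify the first term with the derivative of
    [V] along the trajectory ([is_derive_lyapunov]).

    For invariance, [eta = x - xbar] solves the incremental system because the
    linearization error of [phi], read channel by channel, is exactly [dp]
    ([linearization_error_channels]).  Since [lambda <= alpha] and
    [|w| <= wmax] almost everywhere, the dissipation inequality gives
    [V' <= alpha (wmax^2 - V)], that is, [exp (alpha t) (V - wmax^2)] has a
    nonpositive derivative almost everywhere.  That quantity is absolutely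
    continuous ([lyapunov_ac]), and an absolutely continuous function with
    almost everywhere nonpositive derivative does not increase
    ([ac_ae_derive_le0]); hence [V <= wmax^2] propagates from [t0].  The
    monotonicity statement is proved without integration, by covering the
    exceptional null set by an open set of small measure and chaining intervals
    that are small with respect to a gauge ([segment_gauge_chain]).

    It remains to see that [eta] in the state ellipsoid puts [K eta] in the
    input ellipsoid.  This needs a genuine positive semidefinite square root
    [S] of [M = c K Q K^T] ([possemidef_sqrt], by spectral theory over the
    complex numbers); then [K eta = S y] with [|y| <= 1] by the Cauchy-Schwarz
    inequality for the form [Q] ([feedback_in_input_ellipsoid]). *)

(** * Quadratic forms and the pointwise dissipation inequality *)

Lemma symmetricmxP (F : fieldType) n (M : 'M[F]_n) :
  reflect (M^T = M) (M \is symmetricmx).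
Proof.
by apply: (iffP (is_hermitianmxP _ _ _)); rewrite expr0 scale1r map_mx_id.
Qed.

Definition dot (R : realType) (n : nat) (u v : 'cV[R]_n) : R := (u^T *m v) 0 0.

Section dot.
Variables (R : realType).
Implicit Types n m : nat.

Lemma dotE n (u v : 'cV[R]_n) : dot u v = \sum_i u i 0 * v i 0.
Proof. by rewrite /dot mxE; apply: eq_bigr => i _; rewrite mxE. Qed.

Lemma dotC n (u v : 'cV[R]_n) : dot u v = dot v u.
Proof. by rewrite !dotE; apply: eq_bigr => i _; rewrite mulrC. Qed.

Lemma dotDr n (u v w : 'cV[R]_n) : dot u (v + w) = dot u v + dot u w.
Proof. by rewrite /dot mulmxDr mxE. Qed.

Lemma dotDl n (u v w : 'cV[R]_n) : dot (u + v) w = dot u w + dot v w.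
Proof. by rewrite dotC dotDr !(dotC w). Qed.

Lemma dotNr n (u v : 'cV[R]_n) : dot u (- v) = - dot u v.
Proof. by rewrite /dot mulmxN mxE. Qed.

Lemma dotZr n (u v : 'cV[R]_n) a : dot u (a *: v) = a * dot u v.
Proof. by rewrite /dot -scalemxAr mxE. Qed.

Lemma dotZl n (u v : 'cV[R]_n) a : dot (a *: u) v = a * dot u v.
Proof. by rewrite dotC dotZr dotC. Qed.

Lemma dot_trmx m n (M : 'M[R]_(m, n)) (u : 'cV_m) (v : 'cV_n) :
  dot (M^T *m u) v = dot u (M *m v).
Proof. by rewrite /dot trmx_mul trmxK mulmxA. Qed.

Lemma dot_trmxr m n (M : 'M[R]_(n, m)) (u : 'cV_m) (v : 'cV_n) :
  dot u (M^T *m v) = dot (M *m u) v.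
Proof. by rewrite -dot_trmx trmxK. Qed.

Lemma dot_col_mx m n (u u' : 'cV[R]_m) (v v' : 'cV[R]_n) :
  dot (col_mx u v) (col_mx u' v') = dot u u' + dot v v'.
Proof. by rewrite /dot tr_col_mx mul_row_col mxE. Qed.

Lemma qformE n (M : 'M[R]_n) v : qform M v = dot v (M *m v).
Proof. by rewrite /qform /dot mulmxA. Qed.

Lemma dot_ge0 n (v : 'cV[R]_n) : 0 <= dot v v.
Proof. by rewrite dotE sumr_ge0// => i _; rewrite -expr2 sqr_ge0. Qed.

Lemma dot_eq0 n (v : 'cV[R]_n) : dot v v = 0 -> v = 0.
Proof.
move=> /eqP; rewrite dotE psumr_eq0 => [/allP v0|i _]; last first.
  by rewrite -expr2 sqr_ge0.
apply/colP => i; rewrite mxE.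
by have := v0 i (mem_index_enum _); rewrite -expr2 sqrf_eq0 => /eqP.
Qed.

Lemma posdef_unitmx n (M : 'M[R]_n) : posdef M -> M \in unitmx.
Proof.
move=> [_ Mpos]; rewrite -unitmx_tr -row_free_unit -kermx_eq0.
apply/rowV0P => u /sub_kermxP uM; apply/eqP/negPn/negP => u0.
have := Mpos u^T; rewrite -(inj_eq trmx_inj) trmxK trmx0 => /(_ u0).
by rewrite qformE -[M *m _]trmxK trmx_mul trmxK uM trmx0 /dot mulmx0 mxE ltxx.
Qed.

(** [deta] is the velocity of the incremental system at [eta = Q zeta],
    [xi = Y zeta], and the left-hand side is [V' + alpha V - lambda |w|^2]
    written in terms of [zeta = Q^-1 eta].  The feedthrough [T12], [T21] of the
    multiplier is eliminated with [p = T22^-1 (b - T21 dq)], which is where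
    [Lambda] and [Sigma] come from: [a = Sigma dq + Lambda b]. *)
Lemma dlmi_dissipation (nx nu nw nq np : nat) (alpha lambda : R)
    (A : 'M[R]_nx) (B : 'M[R]_(nx, nu)) (F : 'M[R]_(nx, nw))
    (E : 'M[R]_(nx, np)) (C : 'M[R]_(nq, nx)) (D : 'M[R]_(nq, nu))
    (G : 'M[R]_(nq, nw)) (T : 'M[R]_(nq + np)) (Q dQ : 'M[R]_nx)
    (Y : 'M[R]_(nu, nx)) (N1 : 'M[R]_nq) (N2 : 'M[R]_np)
    (dp : 'cV[R]_nq -> 'cV[R]_np) (zeta : 'cV[R]_nx) (w : 'cV[R]_nw) :
  drsubmx T \in unitmx -> iqc_pairs T dp (N1, N2) ->
  negsemidef (dlmi_matrix alpha A B F E C D G T Q dQ Y lambda N1 N2) ->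
  let dq := C *m (Q *m zeta) + D *m (Y *m zeta) + G *m w in
  let deta := A *m (Q *m zeta) + B *m (Y *m zeta) + F *m w + E *m dp dq in
  2 * dot zeta deta - qform dQ zeta + alpha * qform Q zeta
    - lambda * sqnorm2 w <= 0.
Proof.
move=> T22u [/= N1s N2s N1u N2u [_ iqc]] [_ lmi].
set dq := C *m _ + _ + _; set p := dp dq => /=.
move: {iqc}(iqc dq); rewrite -/p => iqc.
move: iqc lmi; rewrite /dlmi_matrix/=.
set T11 := ulsubmx T; set T12 := ursubmx T.
set T21 := dlsubmx T; set T22 := drsubmx T in T22u *.
set La := T12 *m invmx T22; set Si := T11 - La *m T21.
pose b := T21 *m dq + T22 *m p; pose a := Si *m dq + La *m b.
have pE : p = invmx T22 *m (b - T21 *m dq) by rewrite /b addrC addKr mulKmx.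
have TE : T *m col_mx dq p = col_mx a b.
  rewrite -[T]submxK -/T11 -/T12 -/T21 -/T22 mul_block_col; congr col_mx.
  rewrite /a /b /Si /La mulmxBl mulmxDr -!mulmxA mulKmx //.
  by rewrite addrA subrK.
clearbody La Si.
pose n1 := invmx N1 *m a; pose n2 := invmx N2 *m b.
have N1n : N1 *m n1 = a by rewrite mulKVmx.
have N2n : N2 *m n2 = b by rewrite mulKVmx.
have -> : qform (T^T *m block_mx (invmx N1) 0 0 (- invmx N2) *m T)
            (col_mx dq p) = dot n1 a - dot n2 b.
  rewrite qformE -!mulmxA dot_trmxr TE mul_block_col !mul0mx addr0 add0r.
  by rewrite dot_col_mx mulNmx dotNr -/n1 -/n2 !(dotC a) !(dotC b).
move=> iqc.
(* This test vector turns the blocks -N1 and -N2 into -a^T N1^-1 a and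
   -b^T N2^-1 b, and every off-diagonal block into a pairing with a or b. *)
move=> /(_ (col_mx zeta (col_mx (col_mx n2 w) n1))).
pose g := C *m (Q *m zeta) + D *m (Y *m zeta).
have gE : (C *m Q + D *m Y) *m zeta = g by rewrite mulmxDl -!mulmxA.
rewrite !qformE !mul_block_col !dot_col_mx !mul_col_mx !mul_row_col.
rewrite !mul0mx addr0 add0r.
rewrite !(add_col_mx, dotDr, dot_col_mx).
rewrite dot_trmxr !mul_col_mx !dot_col_mx 3!mulmxDl.
rewrite !(mulmxDl, mulNmx, dotDr, dotNr).
rewrite -!mulmxA gE -scalemxAl dotZr mul_scalar_mx dotZr.
rewrite [dot zeta (_^T *m zeta)]dot_trmxr [dot (_ *m zeta) zeta]dotC.
rewrite !(mulmxDl, mulNmx) -!mulmxA gE -scalemxAl !(dotDr, dotNr) dotZr.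
rewrite ![dot _ n2]dotC ![dot _ w]dotC ![dot _ n1]dotC.
have N2b x : dot n2 (N2 *m x) = dot b x.
  by rewrite -{1}(symmetricmxP _ N2s) dot_trmxr N2n.
rewrite !N2b N1n N2n.
have aE : dot n1 a =
    dot n1 (Si *m g) + dot n1 (Si *m (G *m w)) + dot n1 (La *m b).
  by rewrite /a /dq -/g !mulmxDr !dotDr.
have EpE : dot zeta (E *m p) =
    dot zeta (E *m (invmx T22 *m b)) -
    dot zeta (E *m (invmx T22 *m (T21 *m g))) -
    dot zeta (E *m (invmx T22 *m (T21 *m (G *m w)))).
  by rewrite pE /dq -/g !(mulmxDr, mulmxN, dotDr, dotNr) opprD addrA.
rewrite EpE aE !(dotDr, dotNr) !dot_trmxr ![dot _ zeta]dotC ![dot _ n1]dotC.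
rewrite -[sqnorm2 w]/(dot w w).
rewrite aE [dot n2 _]dotC in iqc.
lra.
Qed.
End dot.

(** * Positive semidefinite square roots and the input ellipsoid *)

(** Adding one node [a] to an interpolant of [s] only requires a multiple of
    [\prod_(b <- s) ('X - b)], which does not change the values on [s]. *)
Lemma poly_interpolation (F : fieldType) (s : seq F) (h : F -> F) :
  exists p : {poly F}, {in s, forall x, p.[x] = h x}.
Proof.
elim: s => [|a s [p ps]]; first by exists 0.
have [as_|/negPf as_] := boolP (a \in s).
  by exists p => x; rewrite inE => /predU1P[->|]; exact: ps.
pose q : {poly F} := \prod_(b <- s) ('X - b%:P).
have qa : q.[a] != 0 by rewrite -rootE root_prod_XsubC as_.
exists (p + ((h a - p.[a]) / q.[a])%:P * q) => x.
rewrite inE !hornerE => /predU1P[->|xs]; first by rewrite divfK// subrKC.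
have /rootP -> : root q x by rewrite root_prod_XsubC.
by rewrite mulr0 addr0 ps.
Qed.

Lemma trmx_horner_mx (F : comNzRingType) n (M : 'M[F]_n.+1) (p : {poly F}) :
  M^T = M -> (horner_mx M p)^T = horner_mx M p.
Proof.
move=> MT; elim/poly_ind: p => [|p c IHp]; first by rewrite rmorph0 trmx0.
rewrite rmorphD rmorphM/= horner_mx_X horner_mx_C raddfD/= tr_scalar_mx.
rewrite -mulmxE trmx_mul MT IHp; congr (_ + _).
by have := comm_horner_mx p (comm_mx_refl M).
Qed.

Section psd_sqrt.
Variable R : realType.

Lemma possemidef_eigenvalue n (M : 'M[R]_n) c :
  possemidef M -> eigenvalue M c -> 0 <= c.
Proof.
move=> [_ Mpos] /eigenvalueP[v vM v0].
have := Mpos v^T; rewrite /qform trmxK vM -scalemxAl mxE.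
have := dot_ge0 v^T; rewrite le_eqVlt => /predU1P[/esym/dot_eq0|].
  by move=> /(congr1 trmx); rewrite trmxK trmx0 => /eqP; rewrite (negPf v0).
by rewrite /dot trmxK => vv; rewrite pmulr_lge0.
Qed.

(** Over the complex numbers [M] is unitarily diagonalizable with nonnegative
    real eigenvalues [c i].  If the real polynomial [r] interpolates the fourth
    root at the [c i], then [r ^+ 4 - 'X] vanishes at every eigenvalue, hence
    at [M]; so [W = r(M)] is a real symmetric matrix with [W^4 = M].  Taking
    fourth roots rather than square roots makes positivity of the root
    [W^2 = W^T W] immediate. *)
Lemma possemidef_sqrt n (M : 'M[R]_n) :
  possemidef M -> exists S, possemidef S /\ S *m S = M.
Proof.
case: n M => [M _|n M Mpsd].
  exists 0; split; last by apply/matrixP => -[].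
  split; first by apply/symmetricmxP; rewrite trmx0.
  by move=> v; rewrite qformE mul0mx /dot mulmx0 mxE.
have MT : M^T = M by exact/symmetricmxP/(proj1 Mpsd).
pose toC : {rmorphism R -> R[i]} := real_complex R.
pose MC := map_mx toC M.
have MCs : MC \is symmetricmx by apply/symmetricmxP; rewrite /MC map_trmx MT.
have MCr : MC \is a mxOver Num.real.
  apply/mxOverP => i j; rewrite mxE; apply/CrealP.
  by apply/eqP; rewrite eq_complex/= oppr0 !eqxx.
have /orthomx_spectralP := symmetric_normalmx MCs MCr.
set P := spectralmx MC; set d := spectral_diag MC => MCE.
have Pu : P \in unitmx by exact: spectral_unit.
have dr : d \is a mxOver Num.real.
  exact/hermitian_spectral_diag_real/realsym_hermsym.
clearbody P d.
pose c i := complex.Re (d 0 i).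
have dc i : d 0 i = toC (c i).
  by rewrite [RHS]complexRe; apply/esym/Creal_ReP/(mxOverP dr).
have c0 i : 0 <= c i.
  apply: possemidef_eigenvalue Mpsd _.
  (* The i-th row of P is an eigenvector of MC for c i, and eigenvalues of a
     real matrix do not depend on the field of scalars. *)
  rewrite -(eigenvalue_map toC) -dc; apply/eigenvalueP; exists (row i P).
    rewrite -/MC MCE -row_mul !mulmxA mulmxV// mul1mx row_mul row_diag_mx.
    by rewrite -scalemxAl -rowE.
  apply/eqP => Pi0; have := row_free_unit P; rewrite Pu => /row_freeP[B PB].
  have : row i (P *m B) = 0 by rewrite row_mul Pi0 mul0mx.
  rewrite PB row1 => /rowP/(_ i); rewrite !mxE !eqxx => /eqP.
  by rewrite oner_eq0.
have [r rE] := poly_interpolation [seq c i | i <- enum 'I_n.+1]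
  (fun x => Num.sqrt (Num.sqrt x)).
have r4 i : r.[c i] ^+ 4 = c i.
  rewrite rE; last by apply: map_f; rewrite mem_enum.
  by rewrite (exprM _ 2 2) !sqr_sqrtr// sqrtr_ge0.
have rM : horner_mx M (r ^+ 4) = M.
  apply: (@map_mx_inj _ _ toC); rewrite map_horner_mx -/MC.
  rewrite [in LHS]MCE.
  rewrite horner_mx_uconjC// horner_mx_diag [RHS]MCE.
  rewrite [map_mx _ d](_ : _ = d)//; apply/rowP => i; rewrite mxE dc.
  by rewrite horner_map /= hornerE/= r4.
pose W := horner_mx M r.
have WT : W^T = W by exact: trmx_horner_mx.
exists (W *m W); split.
  split; first by apply/symmetricmxP; rewrite trmx_mul WT.
  by move=> v; rewrite qformE -mulmxA -{1}WT dot_trmxr dot_ge0.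
by rewrite mulmxE -[RHS]rM rmorphXn /= -mulrA !exprS expr0 mulr1.
Qed.

Lemma sqrtmxP n (M : 'M[R]_n) :
  possemidef M -> possemidef (sqrtmx M) /\ sqrtmx M *m sqrtmx M = M.
Proof.
move=> /possemidef_sqrt[S SM]; rewrite /sqrtmx.
exact: (@xgetPex _ 0 [set S | _]) (ex_intro _ S SM).
Qed.

(** With [M = c K Q K^T] and [S = sqrtmx M], a vector orthogonal to the range of
    [M] is killed by [K^T], so [K eta = M p] for some [p], and [y = S p]
    satisfies [S y = K eta].  Writing [g = K^T p], both [c g^T Q g] and
    [g^T eta] equal [N = |y|^2]; expanding the [Q]-norm of [c g - Q^-1 eta]
    gives [0 <= c N - 2 c N + eta^T Q^-1 eta], whence [N <= 1].  When [c = 0]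
    the state ellipsoid is reduced to the origin. *)
Lemma feedback_in_input_ellipsoid nx nu (c : R) (Q : 'M[R]_nx)
    (K : 'M[R]_(nu, nx)) (eta : 'cV_nx) :
  posdef Q -> 0 <= c -> state_ellipsoid c Q eta ->
  input_ellipsoid c Q K (K *m eta).
Proof.
move=> Qpd c0; rewrite /state_ellipsoid/= qformE => etaQ.
have Qu := posdef_unitmx Qpd.
have [/symmetricmxP QT Qpos] := Qpd.
have Qge0 v : 0 <= dot v (Q *m v).
  have [->|/Qpos/ltW] := eqVneq v 0; first by rewrite /dot !mulmx0 mxE.
  by rewrite qformE.
have zE : eta = Q *m (invmx Q *m eta) by rewrite mulKVmx.
pose M := c *: (K *m Q *m K^T).
have Mdot u v : dot u (M *m v) = c * dot (K^T *m u) (Q *m (K^T *m v)).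
  by rewrite -scalemxAl dotZr -!mulmxA dot_trmx.
have Mpsd : possemidef M.
  split; last by move=> v; rewrite qformE Mdot mulr_ge0.
  by apply/symmetricmxP; rewrite linearZ/= !trmx_mul trmxK QT mulmxA.
have [[/symmetricmxP ST _] SS] := sqrtmxP Mpsd.
have [c00|cn0] := eqVneq c 0.
  have eta0 : eta = 0.
    apply/eqP/negPn/negP => e0.
    have : invmx Q *m eta != 0.
      by apply: contra_neq e0 => e0; rewrite zE e0 mulmx0.
    by move=> /Qpos; rewrite qformE -zE dotC ltNge (le_trans etaQ)// c00.
  exists 0; last by rewrite eta0 !mulmx0.
  by rewrite /= /norm2 /sqnorm2 mulmx0 mxE sqrtr0.
have {}c0 : 0 < c by rewrite lt_neqAle eq_sym cn0.
have [p pE] : exists p, M *m p = K *m eta.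
  have /submxP[D KD] : ((K *m eta)^T <= M)%MS.
    rewrite submxE; apply/eqP/matrixP => i j; rewrite (ord1 i) [RHS]mxE.
    pose v := col j (cokermx M).
    have Mv : M *m v = 0 by rewrite /v colE mulmxA mulmx_coker mul0mx.
    have Kv : K^T *m v = 0.
      apply/eqP/negPn/negP => /Qpos; rewrite qformE.
      have /eqP : dot v (M *m v) = 0 by rewrite Mv /dot mulmx0 mxE.
      by rewrite Mdot mulf_eq0 (negPf cn0) => /eqP ->; rewrite ltxx.
    transitivity (dot (K *m eta) v).
      rewrite /dot [RHS]mxE [LHS]mxE; apply: eq_bigr => k _.
      by rewrite [v _ _]mxE.
    by rewrite dotC -dot_trmx Kv /dot trmx0 mul0mx mxE.
  exists D^T; apply: trmx_inj; rewrite KD trmx_mul trmxK.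
  by have [/symmetricmxP -> _] := Mpsd.
pose y := sqrtmx M *m p.
exists y; last by rewrite /y mulmxA -/M SS.
pose N := dot y y.
have NE : N = dot p (M *m p).
  by rewrite /N /y -{1}ST dot_trmx mulmxA SS.
pose g := K^T *m p.
have Ng : N = c * dot g (Q *m g) by rewrite NE Mdot.
have Ne : N = dot g eta by rewrite NE pE /g dot_trmx.
pose z := invmx Q *m eta.
have /= := Qge0 (c *: g - z).
rewrite -scaleN1r mulmxDr !dotDr !dotDl -!scalemxAr !dotZr !dotZl -zE -/z.
have -> : dot z (Q *m g) = N by rewrite -QT dot_trmxr -zE dotC Ne.
rewrite -Ne (dotC z) => h.
rewrite /= /norm2 -[sqnorm2 y]/N -[leRHS]sqrtr1 ler_sqrt//.
have {}h : 0 <= c * N - 2 * c * N + c.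
  apply: le_trans h _; rewrite Ng.
  move: etaQ; rewrite -/z; nra.
by rewrite -(ler_pM2l c0); lra.
Qed.
End psd_sqrt.

(** * Absolutely continuous functions on a segment *)

(** Cousin's lemma in relational form: a transitive relation that holds between
    the end points of every small enough interval around (and containing) each
    point holds between the end points of the segment.  The supremum of the
    points that can be reached from [a] is itself reached, and cannot be
    smaller than [b]. *)
Lemma segment_gauge_chain (R : realType) (a b : R) (P : R -> R -> Prop) :
  (forall s t u, a <= s -> s <= t -> t <= u -> u <= b ->
     P s t -> P t u -> P s u) ->
  (forall t, a <= t <= b -> exists2 d : R, 0 < d & forall u v,
     a <= u -> u <= t -> t <= v -> v <= b -> t - u < d -> v - t < d -> P u v) ->
  a <= b -> P a b.
Proof.
move=> Ptrans Ploc ab.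
pose S := [set t | a <= t <= b /\ P a t].
have Sa : S a.
  split; first by rewrite lexx.
  have /Ploc[d d0] : a <= a <= b by rewrite lexx.
  by apply; rewrite ?subrr// lexx.
have Sub : ubound S b by move=> t [/andP[]].
have Shs : has_sup S by split; [exists a | exists b].
pose s := sup S.
have sb : s <= b by apply: ge_sup => //; exists a.
have as_ : a <= s by apply: ub_le_sup => //; exists b.
have /Ploc[d d0 dP] : a <= s <= b by rewrite as_.
have [r Sr rs] := sup_adherent d0 Shs.
have [/andP[ar rb] Par] := Sr.
have rles : r <= s by apply: ub_le_sup => //; exists b.
pose v := Num.min b (s + d / 2).
have vb : v <= b by rewrite ge_min lexx.
have sv : s <= v by rewrite le_min sb lerDl divr_ge0// ltW.
have Pav : P a v.
  apply: (Ptrans a r v) => //; first exact: le_trans rles sv.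
  apply: dP => //; first by rewrite -/s in rs; lra.
  have : v <= s + d / 2 by rewrite ge_min lexx orbT.
  lra.
have Sv : S v by split; [rewrite vb (le_trans as_ sv)|].
have vs : v <= s by apply: ub_le_sup => //; exists b.
suff <- : v = b by [].
move: vs; rewrite /v ge_min => /orP[bs|]; last by lra.
by apply/eqP; rewrite eq_le vb (le_trans bs sv).
Qed.

Section ac.
Variables (R : realType) (a b : R).

(** The increments of sums, products, inverses, entries, ... are all controlled
    linearly by those of at most two absolutely continuous functions; the
    closure properties below are instances of this one. *)
Lemma ac_dominated (V1 V2 W : normedModType R) (g1 : R -> V1) (g2 : R -> V2)
    (h : R -> W) (L : R) :
  absolutely_continuous_on a b g1 -> absolutely_continuous_on a b g2 ->
  (forall u v, a <= u -> u <= v -> v <= b ->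
     `|h v - h u| <= L * (`|g1 v - g1 u| + `|g2 v - g2 u|)) ->
  absolutely_continuous_on a b h.
Proof.
move=> g1ac g2ac hL e e0.
pose M := `|L| + 1.
have M0 : 0 < M by rewrite ltr_wpDl.
have e20 : 0 < e / (2 * M) by rewrite divr_gt0// mulr_gt0.
have [d1 d10 g1d] := g1ac _ e20; have [d2 d20 g2d] := g2ac _ e20.
exists (Num.min d1 d2) => [|m l r lr disj]; first by rewrite lt_min d10.
rewrite lt_min => /andP[/(g1d _ _ _ lr disj) s1 /(g2d _ _ _ lr disj) s2].
apply: (@le_lt_trans _ _ (\sum_k
    M * (`|g1 (r k) - g1 (l k)| + `|g2 (r k) - g2 (l k)|))).
  apply: ler_sum => k _; have [al [lrk rb]] := lr k.
  apply: le_trans (hL _ _ al lrk rb) _.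
  apply: ler_wpM2r; first by rewrite addr_ge0.
  by rewrite (le_trans (ler_norm L))// lerDl.
rewrite -mulr_sumr big_split/=.
apply: (@lt_le_trans _ _ (M * (e / (2 * M) + e / (2 * M)))).
  by rewrite ltr_pM2l// ltrD.
by rewrite le_eqVlt; apply/orP; left; apply/eqP; field; rewrite gt_eqF.
Qed.

Lemma ac_id : absolutely_continuous_on a b (fun t : R => t : R^o).
Proof.
move=> e e0; exists e => // m l r lr _ /le_lt_trans; apply.
apply: ler_sum => k _; have [_ [lrk _]] := lr k.
by rewrite ger0_norm// subr_ge0.
Qed.

Lemma ac_modulus (V : normedModType R) (g : R -> V) e :
  absolutely_continuous_on a b g -> 0 < e -> exists2 d : R, 0 < d &
    forall u v, a <= u -> u <= v -> v <= b -> v - u < d -> `|g v - g u| < e.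
Proof.
move=> gac e0; have [d d0 gd] := gac _ e0; exists d => // u v au uv vb uvd.
have := gd 1%N (fun=> u) (fun=> v); rewrite !big_ord1; apply => //.
by move=> j k; rewrite (ord1 j) (ord1 k) eqxx.
Qed.

Lemma ac_bounded (V : normedModType R) (g : R -> V) : a <= b ->
  absolutely_continuous_on a b g ->
  exists2 M : R, 0 <= M & forall t, a <= t <= b -> `|g t| <= M.
Proof.
move=> ab gac; have [d d0 gd] := ac_modulus gac ltr01.
suff [M MP] : exists M, forall t, a <= t <= b -> `|g t| <= M.
  exists M => //; apply: le_trans (MP a _); first by [].
  by rewrite lexx.
pose P u v := exists M, forall t, u <= t <= v -> `|g t| <= M.
apply: (@segment_gauge_chain _ a b P) => //.
  move=> s t u _ _ _ _ [M1 M1P] [M2 M2P].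
  exists (Num.max M1 M2) => x /andP[sx xu].
  have [xt|/ltW tx] := leP x t; rewrite le_max.
    by rewrite M1P ?sx.
  by rewrite M2P ?tx// orbT.
move=> t _; exists (d / 2); first by rewrite divr_gt0.
move=> u v au ut tv vb utd tvd; exists (1 + `|g u|) => x /andP[ux xv].
rewrite -[g x](subrK (g u)); apply: le_trans (ler_normD _ _) _.
by rewrite lerD2r ltW// gd//; [exact: le_trans xv _ | lra].
Qed.

Lemma ac_bounded_away (f : R -> R) : a <= b ->
  absolutely_continuous_on a b (f : R -> R^o) ->
  (forall t, a <= t <= b -> f t != 0) ->
  exists2 c : R, 0 < c & forall t, a <= t <= b -> c <= `|f t|.
Proof.
move=> ab fac f0.
pose P u v := exists2 c : R, 0 < c & forall t, u <= t <= v -> c <= `|f t|.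
apply: (@segment_gauge_chain _ a b P) => //.
  move=> s t u _ _ _ _ [M1 M10 M1P] [M2 M20 M2P].
  exists (Num.min M1 M2) => [|x /andP[sx xu]]; first by rewrite lt_min M10.
  have [xt|/ltW tx] := leP x t; rewrite ge_min.
    by rewrite M1P ?sx.
  by rewrite M2P ?tx// orbT.
move=> t tab; have ft : 0 < `|f t| / 2 by rewrite divr_gt0// normr_gt0 f0.
have [d d0 fd] := ac_modulus fac ft; exists d => //.
move=> u v au ut tv vb utd tvd; exists (`|f t| / 2) => // x /andP[ux xv].
have {}fd : `|f t - f x| < `|f t| / 2.
  have [/andP[at_ tb]] := tab; have [xt|/ltW tx] := leP x t.
    by apply: fd => //; [exact: le_trans ux | lra].
  by rewrite distrC; apply: fd => //; [exact: le_trans xv _ | lra].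
have := ler_normD (f t - f x) (f x); rewrite subrK; lra.
Qed.

Lemma acD (f g : R -> R) :
  absolutely_continuous_on a b (f : R -> R^o) ->
  absolutely_continuous_on a b (g : R -> R^o) ->
  absolutely_continuous_on a b ((fun t => f t + g t) : R -> R^o).
Proof.
move=> fac gac; apply: (ac_dominated (L := 1) fac gac) => u v _ _ _.
by rewrite mul1r opprD addrACA ler_normD.
Qed.

Lemma ac_cst (c : R) : absolutely_continuous_on a b ((fun=> c) : R -> R^o).
Proof.
apply: (ac_dominated (L := 0) ac_id ac_id) => u v _ _ _.
by rewrite subrr normr0 mul0r.
Qed.

Lemma acM (f g : R -> R) : a <= b ->
  absolutely_continuous_on a b (f : R -> R^o) ->
  absolutely_continuous_on a b (g : R -> R^o) ->
  absolutely_continuous_on a b ((fun t => f t * g t) : R -> R^o).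
Proof.
move=> ab fac gac.
have [M M0 fM] := ac_bounded ab fac; have [N N0 gN] := ac_bounded ab gac.
apply: (ac_dominated (L := M + N) fac gac) => u v au uv vb.
have -> : f v * g v - f u * g u = (f v - f u) * g v + f u * (g v - g u) by ring.
apply: le_trans (ler_normD _ _) _; rewrite !normrM.
have fu : `|f u| <= M by rewrite fM// au (le_trans uv).
have gv : `|g v| <= N by rewrite gN// vb (le_trans au).
have /= := normr_ge0 (f v - f u); have /= := normr_ge0 (g v - g u).
set x := `|_|; set y := `|_| => x0 y0.
have := ler_wpM2l y0 gv; have := ler_wpM2r x0 fu; nra.
Qed.

Lemma acV (f : R -> R) : a <= b ->
  absolutely_continuous_on a b (f : R -> R^o) ->
  (forall t, a <= t <= b -> f t != 0) ->
  absolutely_continuous_on a b ((fun t => (f t)^-1) : R -> R^o).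
Proof.
move=> ab fac f0; have [c c0 fc] := ac_bounded_away ab fac f0.
apply: (ac_dominated (L := c^-2) fac fac) => u v au uv vb.
have uab : a <= u <= b by rewrite au (le_trans uv).
have vab : a <= v <= b by rewrite vb (le_trans au).
have -> : (f v)^-1 - (f u)^-1 = - ((f v)^-1 * (f u)^-1 * (f v - f u)).
  by field; rewrite !f0.
have cV t : a <= t <= b -> `|f t|^-1 <= c^-1.
  by move=> tab; rewrite lef_pV2 ?fc// ?posrE ?normr_gt0 ?f0.
rewrite normrN 2!normrM 2!normfV; apply: ler_pM; rewrite ?lerDl//.
by rewrite -exprVn expr2 ler_pM ?invr_ge0 ?cV.
Qed.

Lemma eq_ac (V : normedModType R) (f g : R -> V) :
  (forall t, a <= t <= b -> f t = g t) ->
  absolutely_continuous_on a b f -> absolutely_continuous_on a b g.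
Proof.
move=> fg fac; apply: (ac_dominated (L := 1) fac fac) => u v au uv vb.
by rewrite -!fg ?au ?vb ?(le_trans au uv) ?(le_trans uv vb)// mul1r lerDl.
Qed.

(** The derivative is bounded by some [M] on the compact segment, and the
    Lipschitz bound with constant [M + 1], which holds near every point, chains
    up over intervals. *)
Lemma continuously_differentiable_ac (V : normedModType R) (g : R -> V) :
  a <= b -> continuously_differentiable_on a b g ->
  absolutely_continuous_on a b g.
Proof.
move=> ab [dg dgc gdg].
have [M M0 dgM] : exists2 M, 0 <= M & forall t, a <= t <= b -> `|dg t| <= M.
  have /compact_bounded := continuous_compact dgc (@segment_compact _ a b).
  move=> /pinfty_ex_gt0[M M0 dgM]; exists M; first exact: ltW.
  by move=> t tab; apply: dgM; exists t => //=; rewrite in_itv.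
suff gL u v : a <= u -> u <= v -> v <= b -> `|g v - g u| <= (M + 1) * (v - u).
  apply: (ac_dominated (L := M + 1) ac_id ac_id) => u v au uv vb.
  apply: le_trans (gL _ _ au uv vb) _; apply: ler_wpM2l; first by lra.
  by rewrite (le_trans (ler_norm _))// lerDl.
move: u v => u0 v0 au0 uv0 vb0.
pose P u v := `|g v - g u| <= (M + 1) * (v - u).
apply: (@segment_gauge_chain _ u0 v0 P) => //.
  move=> s t u _ _ _ _ Pst Ptu; rewrite /P -(subrKA (g t)).
  apply: le_trans (ler_normD _ _) _; rewrite /P in Pst Ptu; lra.
move=> t /andP[ut0 tv0].
have tab : a <= t <= b by rewrite (le_trans au0)//= (le_trans tv0).
have := gdg t; rewrite in_itv/= => /(_ tab)/cvgrPdist_lt/(_ _ ltr01).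
rewrite near_withinE near_withinE => /nbhs_ballP[d /= d0 dP].
exists d => // u v u0u ut tv vv0 utd vtd.
have gst s : a <= s <= b -> `|t - s| < d -> `|g s - g t| <= (M + 1) * `|s - t|.
  move=> sab std; have [->|st] := eqVneq s t.
    by rewrite !subrr !normr0 mulr0.
  have := dP s std st; rewrite /= in_itv/= => /(_ sab) h.
  have st0 : s - t != 0 by rewrite subr_eq0.
  rewrite -[g s - g t](scalerKV st0) normrZ mulrC ler_wpM2r//.
  have := ler_normB (dg t) (dg t - (s - t)^-1 *: (g s - g t)).
  have := dgM t tab; rewrite opprB addrC subrK; lra.
rewrite /P -(subrKA (g t)); apply: le_trans (ler_normD _ _) _.
have gv : `|g v - g t| <= (M + 1) * (v - t).
  rewrite -[v - t]ger0_norm ?subr_ge0//; apply: gst.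
    by rewrite (le_trans _ tv) ?(le_trans vv0)//; case/andP: tab.
  by rewrite distrC ger0_norm// subr_ge0.
have gu : `|g t - g u| <= (M + 1) * (t - u).
  rewrite distrC -[t - u]ger0_norm ?subr_ge0// (distrC t u); apply: gst.
    by rewrite (le_trans au0)//= (le_trans ut)//; case/andP: tab.
  by rewrite ger0_norm// subr_ge0.
lra.
Qed.
End ac.

Lemma ac_sub (R : realType) (V : normedModType R) a b a' b' (g : R -> V) :
  a <= a' -> b' <= b ->
  absolutely_continuous_on a b g -> absolutely_continuous_on a' b' g.
Proof.
move=> aa bb gac e e0; have [d d0 gd] := gac _ e0; exists d => // m l r lr.
apply: gd => k; have [? [? ?]] := lr k.
by do !split => //; [exact: le_trans aa _|exact: le_trans bb].
Qed.

(** * Monotonicity from the sign of the derivative almost everywhere *)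

Lemma is_derive_quotient (R : realType) (V : normedModType R) (g : R -> V)
    dg (t e : R) :
  is_derive t 1 g dg -> 0 < e -> exists2 d, 0 < d &
    forall s, `|t - s| < d -> s != t ->
      `|dg - (s - t)^-1 *: (g s - g t)| < e.
Proof.
move=> gt e0.
have /cvgrPdist_lt/(_ _ e0) :
    h^-1 *: (g (h *: 1 + t) - g t) @[h --> 0^'] --> dg.
  by have [dbl <-] := gt; exact: dbl.
rewrite near_withinE => /nbhs_ballP[d /= d0 dP]; exists d => // s std.
rewrite -subr_eq0 => st0.
have := dP (s - t); rewrite /ball/= sub0r opprB => /(_ std st0).
by rewrite [_ *: 1]mulr1 subrK.
Qed.

Section slope_off.
Variables (R : realType) (f : R -> R) (U : set R) (e : R).
Hypothesis mU : measurable U.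
Local Notation mu := (@lebesgue_measure R).

(** On [u, v] the increment of [f] is at most [e] per unit length, apart from
    its variation over a finite family of intervals whose total length is paid
    for by the measure of [U] inside [u, v].  Charging the length to
    [U `&` `]u, v]] makes the relation additive along adjacent intervals. *)
Definition slope_le_off (u v : R) : Prop := exists m (l r : 'I_m -> R),
  [/\ forall k, u <= l k /\ l k <= r k /\ r k <= v,
      forall j k, j != k -> r j <= l k \/ r k <= l j,
      ((\sum_k (r k - l k))%:E <= mu (U `&` `]u, v]))%E &
      f v - f u <= e * (v - u) + \sum_k `|f (r k) - f (l k)|].

Lemma slope_le_off_trans s t u : s <= t -> t <= u ->
  slope_le_off s t -> slope_le_off t u -> slope_le_off s u.
Proof.
move=> st tu [m1 [l1 [r1 [lr1 d1 s1 f1]]]] [m2 [l2 [r2 [lr2 d2 s2 f2]]]].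
pose l k := match fintype.split k with inl i => l1 i | inr i => l2 i end.
pose r k := match fintype.split k with inl i => r1 i | inr i => r2 i end.
exists (m1 + m2)%N, l, r.
have sE (F : R -> R -> R) : \sum_k F (r k) (l k) =
    \sum_i F (r1 i) (l1 i) + \sum_i F (r2 i) (l2 i).
  rewrite big_split_ord/=; congr (_ + _); apply: eq_bigr => i _; rewrite /r /l.
    by rewrite (unsplitK (inl i)).
  by rewrite (unsplitK (inr i)).
split.
- move=> k; rewrite /l /r; case: (fintype.split k) => i.
    by have [? [? ?]] := lr1 i; do !split => //; exact: le_trans tu.
  by have [? [? ?]] := lr2 i; do !split => //; exact: le_trans st _.
- move=> j k; rewrite /l /r -(inj_eq (can_inj splitK)).
  case: (fintype.split j) (fintype.split k) => [i [i'|i']|i [i'|i']] jk.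
  + by apply: d1; apply: contra_neq jk => ->.
  + left; have [_ [_ h]] := lr1 i; have [h' _] := lr2 i'.
    exact: le_trans h h'.
  + right; have [_ [_ h]] := lr1 i'; have [h' _] := lr2 i.
    exact: le_trans h h'.
  + by apply: d2; apply: contra_neq jk => ->.
- rewrite (sE (fun x y => x - y)).
  have -> : U `&` `]s, u] = (U `&` `]s, t]) `|` (U `&` `]t, u]).
    rewrite -setIUr; congr (_ `&` _).
    apply/seteqP; split => x /=; rewrite !in_itv/=.
      move=> /andP[-> ->]; rewrite andbT.
      by have [] := leP x t; [left|right].
    move=> [] /andP[? ?]; apply/andP; split=> //; first exact: le_trans tu.
    exact: le_lt_trans st _.
  rewrite [leRHS]measureU; first by rewrite EFinD leeD.
  + by apply: measurableI.
  + by apply: measurableI.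
  + rewrite setIACA setIid; apply/seteqP; split => x //= [_ []].
    rewrite !in_itv/= => /andP[_ xt] /andP[/(le_lt_trans xt)].
    by rewrite ltxx.
- rewrite (sE (fun x y => `|f x - f y|)); lra.
Qed.

Lemma slope_le_off_subset u v : 0 <= e -> u <= v ->
  `]u, v] `<=` U -> slope_le_off u v.
Proof.
move=> e0 uv uvU; exists 1%N, (fun=> u), (fun=> v); split.
- by move=> _; rewrite !lexx.
- by move=> j k; rewrite (ord1 j) (ord1 k) eqxx.
- rewrite big_ord1 (setIidr uvU) lebesgue_measure_itv/= lte_fin.
  by case: ltP => // vu; rewrite lee_fin; lra.
- by rewrite big_ord1 ler_wpDl// ?ler_norm// mulr_ge0 ?subr_ge0.
Qed.

Lemma slope_le_off_derive (t df : R) : 0 < e -> is_derive t 1 f df -> df <= 0 ->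
  exists2 d, 0 < d & forall u v, u <= t -> t <= v -> t - u < d -> v - t < d ->
    slope_le_off u v.
Proof.
move=> e0 /is_derive_quotient/(_ e0)[d d0 fd] df0; exists d => //.
move=> u v ut tv utd tvd.
have fq s : `|t - s| < d -> s != t -> (s - t)^-1 * (f s - f t) <= e.
  move=> std st; have /ltr_normlP[h _] := fd _ std st.
  have : (s - t)^-1 * (f s - f t) - df < e by rewrite -opprB.
  lra.
exists 0%N, (fun=> u), (fun=> v); split.
- by case.
- by case.
- by rewrite big_ord0 measure_ge0.
- rewrite big_ord0 addr0.
  have fv : f v - f t <= e * (v - t).
    have [->|tv'] := eqVneq t v; first by rewrite !subrr mulr0.
    have {}tv' : t < v by rewrite lt_neqAle tv'.
    have := fq v; rewrite distrC ger0_norm ?subr_ge0// => /(_ tvd).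
    by rewrite gt_eqF// ler_pdivrMl ?subr_gt0// (mulrC (v - t)); exact.
  have fu : f t - f u <= e * (t - u).
    have [->|ut'] := eqVneq u t; first by rewrite !subrr mulr0.
    have {}ut' : u < t by rewrite lt_neqAle ut'.
    have := fq u; rewrite ger0_norm ?subr_ge0// => /(_ utd).
    rewrite lt_eqF// -opprB invrN mulNr -mulrN opprB.
    by rewrite ler_pdivrMl ?subr_gt0// (mulrC (t - u)); exact.
  lra.
Qed.
End slope_off.

(** Cover the null set where the derivative is not controlled by an open set [U]
    of measure less than the modulus [d] of absolute continuity for [e].  Every
    point has a neighbourhood on which [slope_le_off] holds, so it holds
    between [a] and [b]: [f b - f a] is at most [e * (b - a)] plus the
    variation of [f] over intervals of total length less than [d], which is
    less than [e]. *)
Lemma ac_ae_derive_le0 (R : realType) (a b : R) (f : R -> R) : a <= b ->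
  absolutely_continuous_on a b (f : R -> R^o) ->
  ae_on a b (fun t => exists2 d, is_derive t 1 f d & d <= 0) ->
  f b <= f a.
Proof.
move=> ab fac [N [mN N0 fN]].
suff fe e : 0 < e -> f b - f a <= e * (b - a + 1).
  rewrite -subr_le0; apply/ler_addgt0Pr => e e0; rewrite add0r.
  have ba : 0 < b - a + 1 by rewrite ltr_wpDl ?subr_ge0.
  have := fe (e / (b - a + 1)); rewrite divfK ?gt_eqF//; apply.
  exact: divr_gt0.
move=> e0; have [d d0 fd] := fac _ e0.
set mu := @lebesgue_measure R in N0 fN.
have [U [oU NU Ud]] : exists U : set R,
    [/\ open U, N `<=` U & (mu U < d%:E)%E].
  have [|U [oU NU Ud]] := @lebesgue_regularity_outer R N d mN _ d0.
    by rewrite [X in (X < _)%E]N0.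
  exists U; split => //; rewrite -(setDUK NU) setUC.
  have mU := measurable_realfun.open_measurable oU.
  by rewrite [X in (X < _)%E]measureU0//; exact: measurableD.
have mU : measurable U := measurable_realfun.open_measurable oU.
have [m [l [r [lr disj lrd fle]]]] : slope_le_off f U e a b.
  apply: (@segment_gauge_chain _ a b (slope_le_off f U e)) => //.
    by move=> s t u _ st tu _; exact: slope_le_off_trans.
  move=> t tab; have [tN|tN] := pselect (N t).
    have /nbhs_ballP[d' d'0 dU] := open_nbhs_nbhs (conj oU (NU _ tN)).
    exists d' => // u v au ut tv vb utd tvd.
    apply: slope_le_off_subset; [exact: ltW|exact: le_trans tv|].
    move=> x /=; rewrite in_itv/= => /andP[ux xv]; apply: dU.
    rewrite /ball/=; have [xt|/ltW tx] := leP x t.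
      by rewrite ger0_norm ?subr_ge0//; lra.
    by rewrite distrC ger0_norm ?subr_ge0//; lra.
  have [df dft df0] : exists2 d, is_derive t 1 f d & d <= 0.
    apply/not_notP => h; apply: tN; apply: fN => /= h'; apply: h; apply: h'.
    by rewrite in_itv.
  have [d' d'0 fd'] := slope_le_off_derive U e0 dft df0.
  by exists d' => // u v _ ut tv _; exact: fd'.
have : \sum_k (r k - l k) < d.
  rewrite -lte_fin; apply: le_lt_trans lrd _; apply: le_lt_trans Ud.
  by apply: le_measure; rewrite ?inE//; apply: measurableI.
move=> /(fd _ _ _ lr disj) h; nra.
Qed.

(** * Determinants, inverses and derivatives of matrix functions *)

(** Determinants and adjugates are polynomial in the entries, so any class of
    scalar functions closed under the ring operations is inherited by them.
    This is used both for absolute continuity and for differentiability. *)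
Section function_ring.
Variables (T : Type) (R : fieldType) (P : (T -> R) -> Prop).
Hypothesis Pcst : forall c, P (fun=> c).
Hypothesis PD : forall f g, P f -> P g -> P (fun t => f t + g t).
Hypothesis PM : forall f g, P f -> P g -> P (fun t => f t * g t).

Lemma function_ring_sum (I : Type) (r : seq I) (F : I -> T -> R) :
  (forall i, P (F i)) -> P (fun t => \sum_(i <- r) F i t).
Proof.
move=> PF; elim: r => [|i r IHr].
  by rewrite (_ : (fun _ => _) = fun=> 0)//; apply/funext => t; rewrite big_nil.
rewrite (_ : (fun _ => _) = fun t => F i t + \sum_(i <- r) F i t).
  exact: PD.
by apply/funext => t; rewrite big_cons.
Qed.

Lemma function_ring_prod (I : Type) (r : seq I) (F : I -> T -> R) :
  (forall i, P (F i)) -> P (fun t => \prod_(i <- r) F i t).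
Proof.
move=> PF; elim: r => [|i r IHr].
  by rewrite (_ : (fun _ => _) = fun=> 1)//; apply/funext => t; rewrite big_nil.
rewrite (_ : (fun _ => _) = fun t => F i t * \prod_(i <- r) F i t).
  exact: PM.
by apply/funext => t; rewrite big_cons.
Qed.

Lemma function_ring_det n (A : T -> 'M[R]_n) :
  (forall i j, P (fun t => A t i j)) -> P (fun t => \det (A t)).
Proof.
move=> PA; apply: function_ring_sum => s; apply: PM; first exact: Pcst.
exact: function_ring_prod.
Qed.

Lemma function_ring_adj n (A : T -> 'M[R]_n) i j :
  (forall i j, P (fun t => A t i j)) -> P (fun t => (\det (A t))^-1) ->
  P (fun t => ((\det (A t))^-1 *: \adj (A t)) i j).
Proof.
move=> PA PV.
rewrite (_ : (fun _ => _) = fun t => (\det (A t))^-1 *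
    ((-1) ^+ (j + i) * \det (row' j (col' i (A t))))); last first.
  by apply/funext => t; rewrite !mxE.
apply: PM => //; apply: PM; first exact: Pcst.
apply: function_ring_det => k l.
rewrite (_ : (fun _ => _) = fun t => A t (lift j k) (lift i l))//.
by apply/funext => t; rewrite !mxE.
Qed.
End function_ring.

Lemma invmxE (R : comUnitRingType) n (A : 'M[R]_n) :
  A \in unitmx -> invmx A = (\det A)^-1 *: \adj A.
Proof. by rewrite /invmx => ->. Qed.

Section matrix_derive.
Variables (R : realFieldType) (V : normedModType R).
Implicit Types (t v : V).

Lemma is_derive_mxP m n (M : V -> 'M[R]_(m, n)) dM t v :
  is_derive t v M dM <-> forall i j, is_derive t v (fun x => M x i j) (dM i j).
Proof.
split=> [[Md dME] i j|Md].
  split; first exact: (derivable_mxP _ _ _).1.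
  by rewrite -dME derive_mx// mxE.
have Mdb : derivable M t v.
  by apply/derivable_mxP => i j; have [] := Md i j.
split=> //; rewrite derive_mx//; apply/matrixP => i j; rewrite mxE.
by have [] := Md i j.
Qed.

Lemma is_derive_mulmx m n p (A : V -> 'M[R]_(m, n)) (B : V -> 'M[R]_(n, p))
    dA dB t v : is_derive t v A dA -> is_derive t v B dB ->
  is_derive t v (fun x => A x *m B x) (dA *m B t + A t *m dB).
Proof.
move=> /is_derive_mxP hA /is_derive_mxP hB; apply/is_derive_mxP => i j.
rewrite (_ : (fun _ => _) =
    \sum_k ((fun x => A x i k) * (fun x => B x k j))); last first.
  by apply/funext => x; rewrite mxE fct_sumE.
rewrite !mxE -big_split/=; apply: is_derive_sum => k.
by apply: is_derive_eq; rewrite addrC; congr (_ + _); rewrite mulrC.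
Qed.

Lemma is_derive_trmx m n (A : V -> 'M[R]_(m, n)) dA t v :
  is_derive t v A dA -> is_derive t v (fun x => (A x)^T) dA^T.
Proof.
move=> /is_derive_mxP hA; apply/is_derive_mxP => i j; rewrite mxE.
rewrite (_ : (fun _ => _) = fun x => A x j i)//.
by apply/funext => x; rewrite mxE.
Qed.

Lemma derivable_invmx n (A : V -> 'M[R]_n) t v :
  (\forall x \near t, A x \in unitmx) -> derivable A t v ->
  derivable (fun x => invmx (A x)) t v.
Proof.
move=> Au /derivable_mxP Ad; apply/derivable_mxP => i j.
pose P f := derivable (f : V -> R) t v.
have Pcst c : P (fun=> c) by exact: derivable_cst.
have PD f g : P f -> P g -> P (fun t => f t + g t) by exact: derivableD.
have PM f g : P f -> P g -> P (fun t => f t * g t) by exact: derivableM.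
have PV : P (fun t => (\det (A t))^-1).
  apply: derivableV; last exact: (function_ring_det Pcst PD PM).
  by rewrite -unitfE; exact: nbhs_singleton Au.
have h : derivable (fun x => ((\det (A x))^-1 *: \adj (A x)) i j) t v :=
  function_ring_adj Pcst PD PM i j Ad PV.
apply: near_eq_derivable h.
by near do rewrite invmxE//.
Unshelve. all: by end_near. Qed.

(** Once the inverse is known to be differentiable, its derivative is read off
    by differentiating [A *m invmx A = 1]. *)
Lemma is_derive_invmx n (A : V -> 'M[R]_n) dA t v :
  (\forall x \near t, A x \in unitmx) -> is_derive t v A dA ->
  is_derive t v (fun x => invmx (A x)) (- (invmx (A t) *m dA *m invmx (A t))).
Proof.
move=> Au Ad; have dV : derivable (fun x => invmx (A x)) t v.
  by apply: derivable_invmx => //; case: Ad.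
split=> //; set dB := 'D_v _ t.
have Bd : is_derive t v (fun x => invmx (A x)) dB by split.
have At : A t \in unitmx := nbhs_singleton Au.
have /near_eq_is_derive : \near t, A t *m invmx (A t) = cst 1%:M t.
  by near do rewrite /= mulmxV//.
move=> /(_ _ _ (is_derive_mulmx Ad Bd)) [_].
rewrite derive_cst => /esym/(congr1 (mulmx (invmx (A t)))).
rewrite mulmxDr mulKmx// mulmx0 mulmxA => /eqP; rewrite addrC addr_eq0.
by move=> /eqP.
Unshelve. all: by end_near. Qed.

End matrix_derive.

(** * The Lyapunov function along a trajectory *)

Section lyapunov.
Variables (R : realType) (a b : R) (n : nat).
Variables (Q : R -> 'M[R]_n) (eta : R -> 'cV[R]_n).

Lemma continuously_differentiable_derivable (V : normedModType R)
    (g : R -> V) t :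
  continuously_differentiable_on a b g -> t \in `]a, b[ -> derivable g t 1.
Proof.
move=> [dg _ gdg]; rewrite in_itv/= => /andP[at_ tb].
have := gdg t; rewrite in_itv/= !ltW// => /(_ isT) h.
apply/cvg_ex; exists (dg t); apply/cvgrPdist_lt => e e0.
move/cvgrPdist_lt : h => /(_ _ e0).
rewrite near_withinE near_withinE => /nbhs_ballP[d /= d0 dP].
rewrite near_withinE; apply/nbhs_ballP.
exists (Num.min d (Num.min (t - a) (b - t))) => /=.
  by rewrite !lt_min d0 !subr_gt0 at_.
move=> h; rewrite /ball/= sub0r normrN !lt_min => /and3P[hd hta hbt] h0.
move: hta hbt => /ltr_normlP[? ?] /ltr_normlP[? ?].
have := dP (h + t); rewrite /ball/= opprD addrCA subrr addr0 normrN => /(_ hd).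
rewrite -subr_eq0 addrK => /(_ h0); rewrite in_itv/= [h *: 1]mulr1; apply.
by apply/andP; split; lra.
Qed.

Lemma is_derive_lyapunov dQ deta t :
  (\forall s \near t, Q s \in unitmx) -> Q t \is symmetricmx ->
  is_derive t 1 Q dQ -> is_derive t 1 eta deta ->
  let zeta := invmx (Q t) *m eta t in
  is_derive t 1 (fun s => qform (invmx (Q s)) (eta s))
    (2 * dot zeta deta - qform dQ zeta).
Proof.
move=> Qu /symmetricmxP QT hQ heta zeta.
have hP := is_derive_invmx Qu hQ.
have := is_derive_mulmx (is_derive_mulmx (is_derive_trmx heta) hP) heta.
move=> /is_derive_mxP/(_ 0 0) h; apply: (is_derive_eq h).
have PT : (invmx (Q t))^T = invmx (Q t) by rewrite trmx_inv QT.
rewrite mulmxDl 2!mxE.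
rewrite -!mulmxA -[(deta^T *m _) 0 0]/(dot deta zeta) -/zeta.
have -> : ((eta t)^T *m
    (- (invmx (Q t) *m (dQ *m invmx (Q t))) *m eta t)) 0 0 = - qform dQ zeta.
  rewrite mulNmx mulmxN mxE qformE; congr (- _).
  by rewrite -!mulmxA -/zeta /dot trmx_mul PT -!mulmxA.
have -> : ((eta t)^T *m (invmx (Q t) *m deta)) 0 0 = dot zeta deta.
  by rewrite /dot trmx_mul PT -mulmxA.
rewrite dotC; ring.
Qed.

(** [V] is a polynomial in the entries of [eta], of [Q] and in [1 / \det Q]; the
    determinant stays away from [0] on the segment. *)
Lemma lyapunov_ac : a <= b ->
  absolutely_continuous_on a b Q -> absolutely_continuous_on a b eta ->
  (forall t, a <= t <= b -> Q t \in unitmx) ->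
  absolutely_continuous_on a b
    ((fun t => qform (invmx (Q t)) (eta t)) : R -> R^o).
Proof.
move=> ab Qac etaac Qu.
pose P f := absolutely_continuous_on a b (f : R -> R^o).
have Pcst c : P (fun=> c) by exact: ac_cst.
have PD f g : P f -> P g -> P (fun t => f t + g t) by exact: acD.
have PM f g : P f -> P g -> P (fun t => f t * g t) by exact: acM.
have Pentry m p (A : R -> 'M[R]_(m, p)) i j :
    absolutely_continuous_on a b A -> P (fun t => A t i j).
  move=> Aac; apply: (ac_dominated (L := 1) Aac Aac) => u v _ _ _.
  rewrite mul1r; apply: ler_wpDr => //.
  have -> : A v i j - A u i j = (A v - A u) i j by rewrite !mxE.
  rewrite [leRHS]/Num.Def.normr/= mx_normrE.
  exact: (le_trans _ (le_bigmax _ _ (i, j))).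
have PQ i j : P (fun t => Q t i j) by exact: Pentry.
have PV : P (fun t => (\det (Q t))^-1).
  apply: acV => //; first exact: function_ring_det.
  by move=> t /Qu; rewrite unitmxE unitfE.
have Pinv i j : P (fun t => invmx (Q t) i j).
  apply: eq_ac (function_ring_adj Pcst PD PM i j PQ PV) => t tab.
  by rewrite invmxE// Qu.
rewrite -/(P _) (_ : (fun _ => _) = fun t => \sum_j
    (\sum_i (eta t i 0 * invmx (Q t) i j)) * eta t j 0); last first.
  apply/funext => t; rewrite /qform mxE; apply: eq_bigr => j _; rewrite mxE.
  by congr (_ * _); apply: eq_bigr => i _; rewrite mxE.
apply: (function_ring_sum Pcst PD) => j; apply: (PM); last exact: Pentry.
by apply: (function_ring_sum Pcst PD) => i; apply: (PM); [exact: Pentry|].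
Qed.
End lyapunov.

(** * Linearization error, channel by channel *)

Section linearization.
Variable R : realType.

Lemma colv_sum_delta n (v : 'cV[R]_n) : v = \sum_j v j 0 *: delta_mx j 0.
Proof.
by rewrite {1}[v]matrix_sum_delta; apply: eq_bigr => i _; rewrite big_ord1.
Qed.

Lemma jacobian_colE m n (g : 'cV[R]_n -> 'cV[R]_m) q v :
  differentiable g q -> jacobian_col g q *m v = 'D_v g q.
Proof.
move=> gd.
rewrite deriveE// [v in RHS]colv_sum_delta linear_sum/=; apply/colP => i.
rewrite mxE summxE; apply: eq_bigr => j _.
by rewrite linearZ/= !mxE deriveE// mulrC.
Qed.

(** A directional derivative only depends on the restriction of the function to
    the line through the point. *)
Lemma is_derive_along (U V W : normedModType R) (f : V -> U) (g : W -> U)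
    x v y w df :
  (forall h : R, f (h *: v + x) = g (h *: w + y)) ->
  is_derive x v f df -> is_derive y w g df.
Proof.
move=> fg; have fg0 : f x = g y by have := fg 0; rewrite !scale0r !add0r.
have E : (fun h : R => h^-1 *: ((f \o shift x) (h *: v) - f x)) =
         (fun h : R => h^-1 *: ((g \o shift y) (h *: w) - g y)).
  by apply/funext => h /=; rewrite fg fg0.
by move=> [fd fdE]; split; [rewrite /derivable -E|rewrite /derive -E].
Qed.

Section channels.
Variables (nc nqo : nat) (nq np : 'I_nc -> nat).
Variables (sel : forall i : 'I_nc, 'I_(nq i) -> 'I_nqo).
Arguments sel : clear implicits.
Hypothesis sel_inj : forall i, injective (sel i).
Variables (phi : 'cV[R]_nqo -> 'cV[R]_(\sum_i np i)%N).
Variables (phi_ : forall i : 'I_nc, 'cV[R]_(nq i) -> 'cV[R]_(np i)).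
Arguments phi_ : clear implicits.
Hypothesis phiE : forall q, phi q = \mxcol_i phi_ i (rowsub (sel i) q).
Hypothesis phi_diff : forall q, differentiable phi q.

(** Along the line [q + h v] the [i]-th block of [phi] and the channel [phi_ i]
    evaluated on the selected entries are the same function of [h]. *)
Lemma is_derive_channel i q v :
  is_derive (rowsub (sel i) q) (rowsub (sel i) v) (phi_ i)
    (submxcol ('D_v phi q) i).
Proof.
have /is_derive_mxP hphi : is_derive q v phi ('D_v phi q).
  by split=> //; exact: diff_derivable.
apply: (is_derive_along (f := fun x => submxcol (phi x) i) (x := q) (v := v)).
  move=> h; rewrite phiE mxcolK; congr phi_.
  by apply/matrixP => k l; rewrite !mxE.
apply/is_derive_mxP => k l; rewrite mxE.
rewrite (_ : (fun _ => _) = fun x => phi x (tagnat.Rank i k) l).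
  exact: hphi.
by apply/funext => x; rewrite mxE.
Qed.

(** As the selection is injective, [rowsub (sel i)] has a linear section [S], so
    every direction in the domain of [phi_ i] is the image of a direction for
    [phi].  Hence the directional derivatives of [phi_ i] inherit linearity from
    the differential of [phi]. *)
Lemma jacobian_channel i q (v : 'cV_nqo) :
  jacobian_col (phi_ i) (rowsub (sel i) q) *m rowsub (sel i) v =
  submxcol (jacobian_col phi q *m v) i.
Proof.
pose S : 'M[R]_(nqo, nq i) := (rowsub (sel i) 1%:M)^T.
have rowsubE p (M : 'M[R]_(nqo, p)) : rowsub (sel i) M = S^T *m M.
  by rewrite trmxK mul_rowsub_mx mul1mx.
have SS (u : 'cV_(nq i)) : rowsub (sel i) (S *m u) = u.
  rewrite rowsubE mulmxA -[RHS]mul1mx; congr (_ *m _).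
  apply/matrixP => k l; rewrite mxE (bigD1 (sel i k))//= big1 => [|j].
    by rewrite !mxE eqxx mul1r addr0 (inj_eq (@sel_inj i)) eq_sym.
  by rewrite !mxE eq_sym => /negPf ->; rewrite mul0r.
rewrite (jacobian_colE v (phi_diff q)).
rewrite -(derive_val (is_derive := is_derive_channel i q v)).
set r := rowsub (sel i) v.
have Dr u : 'D_u (phi_ i) (rowsub (sel i) q) = submxcol ('d phi q (S *m u)) i.
  rewrite -{1}(SS u) (derive_val (is_derive := is_derive_channel i q _)).
  by rewrite deriveE.
rewrite Dr [in LHS](colv_sum_delta r) [in RHS](colv_sum_delta r).
rewrite !mulmx_sumr linear_sum submxcol_sum; apply: eq_bigr => j _.
rewrite -!scalemxAr linearZ/= -colE; apply/colP => k.
by rewrite !mxE Dr !mxE.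
Qed.

Lemma linearization_error_channels q (v : 'cV_nqo) :
  \mxcol_i (phi_ i (rowsub (sel i) q + rowsub (sel i) v)
            - phi_ i (rowsub (sel i) q)
            - jacobian_col (phi_ i) (rowsub (sel i) q) *m rowsub (sel i) v) =
  phi (q + v) - phi q - jacobian_col phi q *m v.
Proof.
rewrite mxcolB mxcolB -[jacobian_col phi q *m v]submxcolK.
congr (_ - _ - _).
- rewrite phiE; apply: eq_mxcol => i; congr phi_.
  by apply/matrixP => k l; rewrite !mxE.
- by rewrite phiE.
- by apply: eq_mxcol => i; rewrite jacobian_channel.
Qed.
End channels.
End linearization.

(** * Almost everywhere inequalities and the comparison argument *)

Section ae_on.
Variable R : realType.
Implicit Types (a b : R) (P : R -> Prop).

Lemma ae_on_sub a b a' b' P Q : a <= a' -> b' <= b ->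
  (forall t, a' <= t <= b' -> P t -> Q t) -> ae_on a b P -> ae_on a' b' Q.
Proof.
move=> aa bb PQ [N [mN N0 PN]]; exists N; split => // t /= /not_implyP[].
rewrite in_itv/= => tab Qt; apply: PN => /= Pt; apply: Qt.
apply: PQ => //; apply: Pt; rewrite in_itv/=; move: tab => /andP[at_ tb].
by rewrite (le_trans aa)// (le_trans tb).
Qed.

Lemma ae_on_and a b P Q : ae_on a b P -> ae_on a b Q ->
  ae_on a b (fun t => P t /\ Q t).
Proof.
move=> [N [mN N0 PN]] [M [mM M0 QM]]; exists (N `|` M); split.
- exact: measurableU.
- by rewrite measureU0.
- move=> t /= /not_implyP[tab /not_andP[nP|nQ]]; [left|right].
    by apply: PN => /= /(_ tab).
  by apply: QM => /= /(_ tab).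
Qed.

Lemma ae_on_interior a b : ae_on a b (fun t => t \in `]a, b[).
Proof.
exists [set a; b]; split.
- by apply: measurableU.
- rewrite measureU0//; last exact: lebesgue_measure_set1.
  exact: lebesgue_measure_set1.
- move=> t /= /not_implyP[]; rewrite !in_itv/= => /andP[at_ tb] /negP.
  rewrite negb_and -!leNgt => /orP[ta|bt]; [left|right]; apply/eqP;
  by rewrite eq_le ?at_ ?tb ?ta ?bt.
Qed.

Lemma ess_sup_on_ae a b (g : R -> R) c :
  (ess_sup_on a b g <= c%:E)%E -> ae_on a b (fun t => g t <= c).
Proof.
move=> /ess_supP[N [mN N0 gN]]; exists (N `&` `[a, b]); split => //.
  exact: measurableI.
move=> t /= /not_implyP[tab gt]; split => //; apply: gN => /=.
by rewrite lee_fin.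
Qed.

Lemma is_derive_continuously_differentiable (V : normedModType R)
    (g dg : R -> V) a b :
  (forall t : R, is_derive t 1 g (dg t)) -> continuous dg ->
  continuously_differentiable_on a b g.
Proof.
move=> gd dgc; exists dg; first exact: continuous_subspaceT.
move=> t _; apply/cvgrPdist_lt => e /(is_derive_quotient (gd t))[d d0 dP].
rewrite !near_withinE; apply/nbhs_ballP; exists d => // s std st _.
exact: dP.
Qed.

Lemma is_derive_expRZ alpha (t : R) :
  is_derive t (1 : R) (fun t : R => expR (alpha * t))
    (alpha * expR (alpha * t)).
Proof.
have dl : is_derive t (1 : R) (fun t : R => alpha * t) alpha.
  by have := is_deriveZ alpha (is_derive_id t (1 : R)); rewrite [_ *: 1]mulr1.
by have := is_derive1_comp (is_derive_expR (alpha * t)) dl; rewrite mulrC.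
Qed.

Lemma expR_ac alpha a b : a <= b ->
  absolutely_continuous_on a b ((fun t => expR (alpha * t)) : R -> R^o).
Proof.
move=> ab; apply: continuously_differentiable_ac => //.
have d := is_derive_expRZ alpha.
apply: is_derive_continuously_differentiable d _ => t.
apply: differentiable_continuous; apply/derivable1_diffP.
by apply: derivableM => //; have [] := d t.
Qed.

(** Integrating factor: [expR (alpha * t) * (v t - c)] has derivative
    [expR (alpha * t) * (v' + alpha * v - alpha * c)]. *)
Lemma ac_gronwall_sublevel alpha c a b (v : R -> R) :
  absolutely_continuous_on a b (v : R -> R^o) ->
  ae_on a b (fun t => exists2 d,
    is_derive t 1 v d & d + alpha * v t <= alpha * c) ->
  v a <= c -> forall t, a <= t <= b -> v t <= c.
Proof.
move=> vac vd va t /andP[at_ tb].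
pose W s := expR (alpha * s) * (v s - c).
have Wta : W t <= W a.
  apply: ac_ae_derive_le0 => //.
    apply: acM => //; first exact: expR_ac.
    by apply: acD; [exact: ac_sub vac|exact: ac_cst].
  apply: ae_on_sub vd => // s _ [d sd dle].
  have hv : is_derive s (1 : R) (fun s => v s - c) d.
    by apply: is_derive_eq; rewrite subr0.
  exists (expR (alpha * s) * (d + alpha * v s - alpha * c)).
    have := is_deriveM (is_derive_expRZ alpha s) hv.
    move=> /is_derive_eq; apply; rewrite /GRing.scale/=; ring.
  by rewrite pmulr_rle0 ?expR_gt0// subr_le0.
have : W t <= 0.
  by apply: le_trans Wta _; rewrite pmulr_rle0 ?expR_gt0// subr_le0.
by rewrite pmulr_rle0 ?expR_gt0// subr_le0.
Qed.

End ae_on.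

(** * The funnel *)

Theorem theorem12 (R : realType) (t0 tf : R) (ht : t0 <= tf)
    (nx nu nw nqo nc : nat) (nq np : 'I_nc -> nat)
    (wmax : R) (hwmax : 0 <= wmax)
    (* nonlinear system *)
    (f : R -> 'cV[R]_nx -> 'cV[R]_nu -> 'cV[R]_nw -> 'cV[R]_nx)
    (hfcont : forall x u w, {within `[t0, tf], continuous (fun t => f t x u w)})
    (hfC1 : forall t, t \in `[t0, tf] -> continuously_differentiable
       (fun z : 'cV[R]_nx * 'cV[R]_nu * 'cV[R]_nw => f t z.1.1 z.1.2 z.2))
    (* linear fractional form *)
    (Ao : R -> 'M[R]_nx) (Bo : R -> 'M[R]_(nx, nu)) (Fo : R -> 'M[R]_(nx, nw))
    (E : 'M[R]_(nx, (\sum_i np i)%N))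
    (Co : 'M[R]_(nqo, nx)) (Do : 'M[R]_(nqo, nu)) (Go : 'M[R]_(nqo, nw))
    (phi : R -> 'cV[R]_nqo -> 'cV[R]_(\sum_i np i)%N)
    (hAo : {within `[t0, tf], continuous Ao})
    (hAob : [bounded Ao t | t in `[t0, tf]])
    (hBo : {within `[t0, tf], continuous Bo})
    (hBob : [bounded Bo t | t in `[t0, tf]])
    (hFo : {within `[t0, tf], continuous Fo})
    (hFob : [bounded Fo t | t in `[t0, tf]])
    (hphi : forall t q, t \in `[t0, tf] -> differentiable (phi t) q)
    (hf : forall t x u w, t \in `[t0, tf] ->
       f t x u w = Ao t *m x + Bo t *m u + Fo t *m w
                   + E *m phi t (Co *m x + Do *m u + Go *m w))
    (* nominal trajectory *)
    (xbar : R -> 'cV[R]_nx) (ubar : R -> 'cV[R]_nu)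
    (hubar : piecewise_continuous t0 tf ubar) (hubar2 : L2_on t0 tf ubar)
    (hbar : is_solution t0 tf f xbar ubar (fun=> 0))
    (* channels: sel i lists the entries of q_o on which channel i depends *)
    (sel : forall i : 'I_nc, 'I_(nq i) -> 'I_nqo)
    (phi_ : forall i : 'I_nc, R -> 'cV[R]_(nq i) -> 'cV[R]_(np i))
    (hsel : forall i, injective (sel i))
    (hch : forall t q, t \in `[t0, tf] ->
       phi t q = \mxcol_i phi_ i t (rowsub (sel i) q))
    (hdep : forall (i : 'I_nc) (k : 'I_(nq i)),
       exists t, exists q q' : 'cV[R]_(nq i),
         [/\ t \in `[t0, tf], (forall l, l != k -> q l 0 = q' l 0) &
             phi_ i t q <> phi_ i t q'])
    (* multiplier transformation *)
    (T : R -> 'M[R]_((\sum_i nq i) + (\sum_i np i))%N)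
    (hT : forall t, t \in `[t0, tf] -> T t \in unitmx)
    (hT22 : forall t, t \in `[t0, tf] -> drsubmx (T t) \in unitmx)
    (* decision variables *)
    (alpha : R) (halpha : 0 < alpha)
    (Q : R -> 'M[R]_nx) (Y : R -> 'M[R]_(nu, nx)) (lambda : R -> R)
    (N1 : R -> 'M[R]_(\sum_i nq i)%N) (N2 : R -> 'M[R]_(\sum_i np i)%N) :
  let qobar := fun t => Co *m xbar t + Do *m ubar t in
  let C_ := fun i => rowsub (sel i) Co in
  let D_ := fun i => rowsub (sel i) Do in
  let G_ := fun i => rowsub (sel i) Go in
  let qbar := fun i t => C_ i *m xbar t + D_ i *m ubar t in
  let C := \mxcol_i C_ i in
  let D := \mxcol_i D_ i in
  let G := \mxcol_i G_ i in
  let Phi := fun t => jacobian_col (phi t) (qobar t) in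
  let A := fun t => Ao t + E *m Phi t *m Co in
  let B := fun t => Bo t + E *m Phi t *m Do in
  let F := fun t => Fo t + E *m Phi t *m Go in
  let dp := delta_p phi_ qbar in
  let incremental := fun t (eta : 'cV[R]_nx) (xi : 'cV[R]_nu) (w : 'cV[R]_nw) =>
    A t *m eta + B t *m xi + F t *m w
    + E *m dp t (C *m eta + D *m xi + G *m w) in
  continuously_differentiable_on t0 tf Q ->
  (forall t, t \in `[t0, tf] -> posdef (Q t)) ->
  piecewise_continuous t0 tf Y ->
  piecewise_continuous t0 tf lambda ->
  (forall t, t \in `[t0, tf] -> 0 <= lambda t) ->
  (forall t, t \in `[t0, tf] -> N1 t \is symmetricmx /\ N2 t \is symmetricmx) ->
  ae_on t0 tf (fun t =>
    [/\ iqc_pairs (T t) (dp t) (N1 t, N2 t),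
        0 <= lambda t <= alpha &
        negsemidef (dlmi_matrix alpha (A t) (B t) (F t) E C D G (T t)
          (Q t) (derive1 Q t) (Y t) (lambda t) (N1 t) (N2 t))]) ->
  let K := fun t => Y t *m invmx (Q t) in
  let V := fun t (eta : 'cV[R]_nx) => qform (invmx (Q t)) eta in
  (forall (eta : R -> 'cV[R]_nx) (w : R -> 'cV[R]_nw),
     admissible_disturbance t0 tf wmax w ->
     is_solution t0 tf incremental eta (fun t => K t *m eta t) w ->
     ae_on t0 tf (fun t =>
       [/\ derivable (fun s => V s (eta s)) t 1,
           derive1 (fun s => V s (eta s)) t + alpha * V t (eta t)
             - lambda t * sqnorm2 (w t) <= 0 &
           0 <= lambda t <= alpha])) /\
  funnel_invariant t0 tf wmax f (wmax ^+ 2) xbar ubar Q K.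
Proof.
move=> qobar C_ D_ G_ qbar C D G Phi A B F dp incremental Qc1 Qpd _ _ _ _ hae.
move=> K V.
have memE t : (t \in `[t0, tf]) = (t0 <= t <= tf) by rewrite in_itv.
have Qu t : t0 <= t <= tf -> Q t \in unitmx.
  by move=> ttf; apply: posdef_unitmx; apply: Qpd; rewrite memE.
have dissip (eta : R -> 'cV[R]_nx) (w : R -> 'cV[R]_nw) :
    is_solution t0 tf incremental eta (fun t => K t *m eta t) w ->
    ae_on t0 tf (fun t => exists d, [/\ is_derive t 1 (fun s => V s (eta s)) d,
        d + alpha * V t (eta t) - lambda t * sqnorm2 (w t) <= 0 &
        0 <= lambda t <= alpha]).
  move=> [_ heta].
  have hint := ae_on_interior t0 tf.
  apply: ae_on_sub (ae_on_and (ae_on_and hae heta) hint) => //.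
  move=> t ttf [[[hN hl hlmi] deta] tint].
  have Qut := Qu t ttf.
  have Qd : is_derive t 1 Q (derive1 Q t).
    split; last by rewrite derive1E.
    exact: continuously_differentiable_derivable Qc1 tint.
  have Qnear : \forall s \near t, Q s \in unitmx.
    move: tint; rewrite in_itv/= => /andP[t0t ttf'].
    near=> s; apply: Qu; apply/andP; split; apply: ltW; near: s.
      exact: lt_nbhsr.
    exact: lt_nbhsl.
  have Qsym : Q t \is symmetricmx by case: (Qpd t (etrans (memE t) ttf)).
  have := is_derive_lyapunov Qnear Qsym Qd deta; set zeta := invmx _ *m _ => hV.
  eexists; split; [exact: hV| |exact: hl].
  have T22u : drsubmx (T t) \in unitmx by apply: hT22; rewrite memE.
  have := dlmi_dissipation zeta (w t) T22u hN hlmi.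
  have Qz : Q t *m zeta = eta t by rewrite /zeta mulKVmx.
  have Yz : Y t *m zeta = K t *m eta t by rewrite /zeta /K mulmxA.
  have Vz : V t (eta t) = qform (Q t) zeta.
    by rewrite /V !qformE Qz dotC.
  by rewrite /= Qz Yz Vz.
split.
  move=> eta w _ /dissip; apply: ae_on_sub => // t _ [d [hd dle hl]].
  split; [exact: ex_derive| |exact: hl].
  by rewrite derive1E (derive_val (is_derive := hd)).
move=> x w u [_ _ wess] [xac xd].
move=> [_ /= -> [eta0 eta0E x0E]] t ttf.
pose eta s := x s - xbar s.
(* The difference of the two trajectories obeys the incremental system: the
   affine parts cancel and phi(qobar + q) - phi(qobar) is Phi q plus dp. *)
have etasol : is_solution t0 tf incremental eta (fun t => K t *m eta t) w.
  case: hbar => xbac xbd; split.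
    apply: (ac_dominated (L := 1) xac xbac) => p q _ _ _.
    rewrite mul1r /eta (_ : _ - _ = (x q - x p) - (xbar q - xbar p)).
      exact: ler_normB.
    by rewrite !opprB [xbar p - x p]addrC addrACA [- xbar q + _]addrC.
  apply: ae_on_sub (ae_on_and xd xbd) => // s stf [dx dxb].
  have hs : s \in `[t0, tf] by rewrite memE.
  rewrite /eta; apply: is_derive_eq; rewrite !hf// !mulmx0 !addr0.
  pose xi := K s *m eta s; pose q := Co *m eta s + Do *m xi + Go *m w s.
  have us : u s = ubar s + xi by [].
  have xs : x s = xbar s + eta s by rewrite /eta subrKC.
  have dpE : dp s (C *m eta s + D *m xi + G *m w s) =
      phi s (qobar s + q) - phi s (qobar s) - Phi s *m q.
    rewrite /Phi.
    rewrite -(linearization_error_channels hsel (phi_ := fun i => phi_ i s));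
      last 2 first.
    - by move=> p; exact: hch.
    - by move=> p; exact: hphi.
    have CE : C *m eta s + D *m xi + G *m w s = \mxcol_i rowsub (sel i) q.
      rewrite /C /D /G !mxcol_mul -!mxcolD; apply: eq_mxcol => i.
      rewrite /C_ /D_ /G_ !mul_rowsub_mx.
      by apply/matrixP => k l; rewrite !mxE.
    have qbE i : qbar i s = rowsub (sel i) (qobar s).
      rewrite /qbar /C_ /D_ !mul_rowsub_mx.
      by apply/matrixP => k l; rewrite !mxE.
    by rewrite CE /dp /delta_p; apply: eq_mxcol => i; rewrite mxcolK qbE.
  have qE : Co *m x s + Do *m u s + Go *m w s = qobar s + q.
    rewrite us xs /q; move: (eta s) (xi) => e z.
    by rewrite !mulmxDr addrACA -[LHS]addrA.
  rewrite -[RHS]/(incremental s (eta s) xi (w s)) /incremental dpE qE.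
  rewrite -/(qobar s) us xs /A /B /F.
  move: (phi s (qobar s + q)); move: (phi s (qobar s)); rewrite /q => f1 f2.
  move: (eta s) (xi) => e z.
  rewrite !(mulmxDl, mulmxDr, mulmxN) -!mulmxA.
  by apply/matrixP => k l; rewrite !(mxE _ _ k l); ring.
have etaac : absolutely_continuous_on t0 tf eta by case: etasol.
have Vle : V t (eta t) <= wmax ^+ 2.
  apply: (@ac_gronwall_sublevel _ alpha _ t0 tf (fun s => V s (eta s))).
  - by apply: lyapunov_ac => //; exact: continuously_differentiable_ac.
  - have wle := ess_sup_on_ae wess.
    apply: ae_on_sub (ae_on_and (dissip _ _ etasol) wle) => // s _.
    move=> [[d [hd dle /andP[l0 la]]] ws]; exists d => //.
    have w2 : sqnorm2 (w s) <= wmax ^+ 2.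
      have s0 : 0 <= sqnorm2 (w s) := dot_ge0 _.
      by rewrite -[leLHS]sqr_sqrtr// ler_pXn2r ?nnegrE ?sqrtr_ge0.
    have s0 : 0 <= sqnorm2 (w s) := dot_ge0 _.
    (* lambda |w|^2 <= alpha wmax^2 as both factors are dominated. *)
    nra.
  - by rewrite /V /eta -x0E [_ + eta0]addrC addrK; exact: eta0E.
  - by rewrite -memE.
split.
  exists (xbar t) => //; exists (eta t) => //.
  by rewrite /eta subrKC.
exists (ubar t) => //; exists (K t *m eta t) => //.
apply: feedback_in_input_ellipsoid => //; first exact: Qpd.
exact: sqr_ge0.
Unshelve. all: by end_near. Qed.
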